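(* Let $a_n = p_n$ be the $n$-th prime. Let $(\eta(N))_{N \geq 1}$ be a strictly decreasing sequence of non-negative reals such that $\eta(2N)/\eta(N) \geq c_0$ for all $N$, for some constant $c_0 > 0$. Let $\mathcal{A}$ be the set of those $\alpha \in [0,1]$ for which $$\delta_{\min}^{\alpha}(N) \leq \eta(N \log N)$$ holds for infinitely many $N$. Then $\lambda(\mathcal{A}) = 0$ or $\lambda(\mathcal{A}) = 1$, according to whether the series $\sum_{N=1}^{\infty} \eta(N)$ is convergent or divergent, respectively.
   Context: $\lambda$ denotes Lebesgue measure. For $\alpha \in [0,1]$ and $N \geq 2$, $\delta_{\min}^{\alpha}(N) = \min\{\|(a_m - a_n)\alpha\| : 1 \leq m,n \leq N,\ m \neq n\}$, where $\|x\|$ is the distance from $x$ to the nearest integer. Here $\log x$ means $\max\{1,\log x\}$. The paper writes the hypothesis as $\eta(2N)/\eta(N) \gg 1$. *)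

(* Defs.v *)
From HB Require Import structures.
From mathcomp Require Import all_boot all_order all_algebra.
From mathcomp Require Import all_classical all_reals all_analysis.
Set Implicit Arguments. Unset Strict Implicit. Unset Printing Implicit Defensive.
Import Order.TTheory GRing.Theory Num.Theory.
Local Open Scope ring_scope.

Definition next_prime (m : nat) : nat :=
  ex_minn (let: exist2 p Hp Hq := prime_above m in
           ex_intro (fun p => (m < p)%N && prime p) p (introT andP (conj Hp Hq))).

(* nth_prime n = p_n, 1-indexed: nth_prime 1 = 2, nth_prime 2 = 3, ...
   (nth_prime 0 = 0 is a dummy value never used) *)
Fixpoint nth_prime (n : nat) : nat :=
  match n with 0 => 0%N | n'.+1 => next_prime (nth_prime n') end.

Definition dist_nint {R : realType} (x : R) : R :=
  Num.min (x - (Num.floor x)%:~R) ((Num.floor x)%:~R + 1 - x).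

(* delta_min^alpha(N) = min_{1<=m,n<=N, m<>n} ||(a_m - a_n) alpha|| with a_n = p_n.
   The neutral element 1 is irrelevant for N >= 2 since ||.|| <= 1/2. *)
Definition delta_min {R : realType} (alpha : R) (N : nat) : R :=
  \big[Num.min/1]_(1 <= m < N.+1)
    \big[Num.min/1]_(1 <= n < N.+1 | m != n)
      dist_nint (((nth_prime m)%:R - (nth_prime n)%:R) * alpha).

Definition logm {R : realType} (x : R) : R := Num.max 1 (ln x).

(* Main.v *)
Require Import Defs.
From HB Require Import structures.
From mathcomp Require Import all_boot all_order all_algebra.
From mathcomp Require Import all_classical all_reals all_analysis.
From mathcomp Require Import measurable_realfun.
From mathcomp Require Import zify ring lra.
Import Order.TTheory GRing.Theory Num.Theory.
Import numFieldNormedType.Exports.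
Local Open Scope classical_set_scope.
Local Open Scope ring_scope.

(* Differences of primes.  A number d is a difference of two primes p - p' with p = O(d) for a
   positive proportion of all d: the number of prime pairs with difference d below X is
   O(X / ln^2 X * (d / phi(d))^2) by the upper bound sieve, while the total number of pairs is of
   order X^2 / ln^2 X by Chebyshev, and (d / phi(d))^3 is bounded on average.  The same average bound
   allows restricting to those d with phi(d) / d bounded below.

   Convergence.  p_N = O(N ln N) makes every alpha of the set satisfy ||d alpha|| <= C eta(d) for
   infinitely many d, and Borel-Cantelli applies.

   Divergence.  Let D be the above set of differences.  Dividing eta by 1 plus its partial sums gives a
   psi = o(eta) whose sum over D still diverges.  The neighbourhoods of radius psi(q) / q of the reduced
   fractions a / q are pairwise quasi-independent, so by Bonferroni the limsup set over q in D has
   positive measure.  The set of alpha with ||q alpha|| <= K psi(q) infinitely often for some K contains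
   it and is stable under multiplication by positive integers and integer translations, so a zoom at a
   density point shows that it has full measure; and K psi <= eta eventually. *)

(** * The upper bound sieve *)

(** The sieve bound carries the square of d / phi(d) because the sum of its weights is bounded below
    by the square of a harmonic sum over integers coprime to 6 d. Since d / phi(d) has bounded
    moments, this loss is harmless. The third power arises because one more factor is spent on
    discarding the d with phi(d) / d < k, where (d / phi(d))^2 <= k (d / phi(d))^3. Taking only
    reduced fractions makes the centres for different q distinct, which removes the diagonal from
    the overlap estimate; the price is that the neighbourhoods have measure 2 psi(q) phi(q) / q,
    hence the lower bound imposed on phi(q) / q. Multiplying alpha by n multiplies the error by n,
    so an invariant set must allow an arbitrary constant K; this forces the passage to psi = o(eta).
    The constants that compare p_N with N log N are rounded up to powers of 2 and paid for with
    powers of c0. *)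

Lemma sum_multiples (R : nmodType) (p y : nat) (F : nat -> R) : (0 < p)%N ->
  \sum_(1 <= a < y.+1 | (p %| a)%N) F a =
  \sum_(1 <= a < (y %/ p).+1) F (p * a)%N.
Proof.
move=> p0; elim: y => [|y IH]; first by rewrite div0n !big_nil.
rewrite big_mkcond big_nat_recr //= -big_mkcond IH divnS //.
case: ifP => py; last by rewrite addr0.
rewrite add1n [RHS]big_nat_recr //=; congr (_ + F _).
by move: (divnK py); rewrite divnS // py add1n mulnC.
Qed.

Definition periodic {T : Type} (m : nat) (G : nat -> T) :=
  forall n, G (n + m)%N = G n.

Lemma periodic_mod {T : Type} m (G : nat -> T) : periodic m G ->
  forall n, G (n %% m)%N = G n.
Proof.
move=> per n; rewrite {2}(divn_eq n m) addnC.
by elim: (n %/ m)%N => [|k IH]; rewrite ?addn0 // mulSn addnCA addnC per.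
Qed.

(** Chinese remainder theorem: as [n] runs over a common period, its residues modulo [m] and modulo
    [p] run independently. *)
Lemma sum_prod_coprime (R : comPzRingType) m p (F G : nat -> R) :
  (0 < m)%N -> (0 < p)%N -> coprime m p -> periodic p F -> periodic m G ->
  \sum_(n < m * p) F n * G n = (\sum_(r < p) F r) * (\sum_(a < m) G a).
Proof.
move=> m0 p0 cop perF perG.
pose h (n : 'I_(m * p)) : 'I_m * 'I_p :=
  (Ordinal (ltn_pmod n m0), Ordinal (ltn_pmod n p0)).
have hinj : injective h.
  move=> n n' [em ep]; apply/val_inj/eqP => /=.
  rewrite -(modn_small (ltn_ord n)) -[X in _ == X](modn_small (ltn_ord n')).
  by rewrite chinese_remainder // em ep !eqxx.
have hbij : bijective h.
  by apply: inj_card_bij hinj _; rewrite card_prod !card_ord.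
rewrite mulrC big_distrlr /= pair_big /= (reindex h) /=; last exact: onW_bij.
by apply: eq_bigr => n _; rewrite mulrC (periodic_mod _ _ perF) (periodic_mod _ _ perG).
Qed.

Lemma sum_prod_primes (R : comPzRingType) (s : seq nat) (g : nat -> nat -> R) :
  uniq s -> all prime s -> (forall p, p \in s -> periodic p (g p)) ->
  \sum_(n < \prod_(p <- s) p) \prod_(p <- s) g p n =
  \prod_(p <- s) \sum_(r < p) g p r.
Proof.
elim: s => [|p s IH] /=; first by rewrite !big_nil big_ord_recl big_ord0 big_nil addr0.
move=> /andP[ps us] /andP[pp als] per; rewrite !big_cons mulnC.
have perprod : periodic (\prod_(q <- s) q) (fun n => \prod_(q <- s) g q n).
  move=> n; apply: eq_big_seq => q qs.
  have /dvdnP[k ->] : (q %| \prod_(q <- s) q)%N.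
    by rewrite (big_rem q) //= dvdn_mulr.
  elim: k => [|k IHk]; rewrite ?addn0 // mulSn addnCA addnC per //.
  by rewrite inE qs orbT.
under eq_bigr do rewrite big_cons.
rewrite (sum_prod_coprime _ _ _ (g p) (fun n => \prod_(q <- s) g q n)) //.
- by rewrite IH // => q qs; apply: per; rewrite inE qs orbT.
- by rewrite big_seq prodn_cond_gt0 // => q /(allP als)/prime_gt0.
- by rewrite prime_gt0.
- rewrite coprime_sym prime_coprime //.
  rewrite big_seq; elim/big_ind: _ => [|a b pa pb|q qs].
  + by rewrite dvdn1; case: eqP pp => // ->.
  + by rewrite Euclid_dvdM // negb_or pa.
  + by rewrite dvdn_prime2 ?(allP als q qs) //; apply/eqP => pq; rewrite pq qs in ps.
- by apply: per; rewrite inE eqxx.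
Qed.

Lemma sum_ord_add (R : nmodType) m n (F : nat -> R) :
  \sum_(i < m + n) F i = \sum_(i < m) F i + \sum_(i < n) F (m + i)%N.
Proof. by rewrite big_split_ord. Qed.

(** Full periods are summed exactly; only the incomplete last one is estimated term by term, which
    costs at most [M]. *)
Lemma sum_periodic_le (R : realFieldType) M X (G : nat -> R) : (0 < M)%N ->
  periodic M G -> (forall n, G n <= 1) ->
  \sum_(n < X) G n <= (X %/ M)%:R * \sum_(n < M) G n + M%:R.
Proof.
move=> M0 per le1.
have -> : \sum_(n < X) G n = \sum_(n < X %/ M * M + X %% M) G n.
  by rewrite -divn_eq.
rewrite sum_ord_add; apply: lerD.
  rewrite le_eqVlt; apply/orP; left; apply/eqP.
  elim: (X %/ M)%N => [|k IH]; first by rewrite mul0n big_ord0 mul0r.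
  rewrite mulSn sum_ord_add -natr1 mulrDl mul1r addrC -IH; congr (_ + _).
  by apply: eq_bigr => i _; rewrite addnC per.
apply: (@le_trans _ _ (\sum_(n < X %% M) 1)); first by apply: ler_sum.
by rewrite sumr_const card_ord ler_nat ltnW ?ltn_pmod.
Qed.

Definition rad (n : nat) : nat := (\prod_(p <- primes n) p)%N.

(** Selberg's quotient omega / (p - omega) with omega = 2, the number of residue classes removed
    modulo [p]: 0 and -d. *)
Definition sieving_weight (R : realFieldType) (p : nat) : R := 2 / (p%:R - 2).

(* When p does not divide d, this function of n has mean zero modulo p. *)
Definition sieving_fun (R : realFieldType) (d p n : nat) : R :=
  if (p %| n * (n + d))%N then - (sieving_weight R p)^-1 else 1.

(** The zeros of r (r + d) modulo [p] are 0 and -d, the latter represented by [p - d %% p]; they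
    differ because [p] does not divide [d]. *)
Lemma sum_two_residues (R : realFieldType) d p (A B : R) :
  prime p -> ~~ (p %| d)%N ->
  \sum_(r < p) (if (p %| r * (r + d))%N then A else B) = A *+ 2 + B * (p%:R - 2).
Proof.
move=> pp pd; have p0 := prime_gt0 pp.
have sp : ((p - d %% p) < p)%N.
  by rewrite ltn_subrL p0 andbT lt0n; apply: contra pd => /eqP h; apply/eqP.
pose o : 'I_p := Ordinal p0; pose s : 'I_p := Ordinal sp.
have so : s != o by apply/eqP => /(congr1 val) /=; have := ltn_pmod d p0; lia.
have E (r : 'I_p) : (p %| r * (r + d))%N = (r == o) || (r == s).
  rewrite Euclid_dvdM // -!val_eqE /=; congr (_ || _).
    by rewrite /dvdn modn_small.
  have hd := ltn_pmod d p0.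
  rewrite {1}(divn_eq d p) addnCA dvdn_addr ?dvdn_mull //.
  apply/idP/eqP => [|->]; last by rewrite subnK // ltnW.
  have dp : (d %% p != 0)%N by [].
  case/dvdnP => -[|[|k]]; have := ltn_ord r; [lia | lia |].
  by rewrite !mulSn; lia.
under eq_bigr do rewrite E.
rewrite (bigD1 o) // (bigD1 s) //= !eqxx orbT mulr2n -addrA; congr (_ + (_ + _)).
rewrite (eq_bigr (fun=> B)); last first.
  by move=> i /andP[/negbTE -> /negbTE ->].
rewrite sumr_const; have -> : #|[pred i : 'I_p | (i != o) && (i != s)]| = (p - 2)%N.
  have := cardC [pred i | (i == o) || (i == s)]; rewrite card_ord.
  rewrite (eq_card (B := pred2 o s)) // card2 eq_sym so /= => cardp.
  suff -> : #|[pred i | i != o & i != s]| =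
      #|predC [pred i | (i == o) || (i == s)]| by rewrite -[in RHS]cardp addKn.
  by apply: eq_card => i; rewrite !inE negb_or.
by rewrite -[LHS]mulr_natr natrB ?prime_gt1.
Qed.

Lemma sieving_weight_gt0 (R : realFieldType) p : (4 < p)%N -> 0 < sieving_weight R p.
Proof. move=> p4; rewrite divr_gt0 // subr_gt0 ltr_nat; lia. Qed.

Lemma sieving_weight_le1 (R : realFieldType) p : (4 < p)%N -> sieving_weight R p <= 1.
Proof.
move=> p4; have p4' : 4%:R < p%:R :> R by rewrite ltr_nat.
by rewrite ler_pdivrMr; lra.
Qed.

Lemma sum_sieving_fun (R : realFieldType) d p : prime p -> (4 < p)%N -> ~~ (p %| d)%N ->
  \sum_(r < p) sieving_fun R d p r = 0.
Proof.
move=> pp p4 pd; have p4' : 4%:R < p%:R :> R by rewrite ltr_nat.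
rewrite sum_two_residues // /sieving_weight.
by field; lra.
Qed.

Lemma sum_sieving_fun_sqr (R : realFieldType) d p : prime p -> (4 < p)%N -> ~~ (p %| d)%N ->
  \sum_(r < p) sieving_fun R d p r ^+ 2 = p%:R / sieving_weight R p.
Proof.
move=> pp p4 pd; have p4' : 4%:R < p%:R :> R by rewrite ltr_nat.
under eq_bigr do rewrite /sieving_fun (fun_if (fun x => x ^+ 2)).
rewrite sum_two_residues // /sieving_weight.
by field; lra.
Qed.

Lemma sieving_fun_periodic (R : realFieldType) d p : periodic p (sieving_fun R d p).
Proof.
move=> n; rewrite /sieving_fun; congr (if _ then _ else _).
by rewrite /dvdn -modnMm -addnA [(p + d)%N]addnC addnA !modnDr modnMm.
Qed.

Lemma prod_subseq (R : comPzRingType) (s t : seq nat) (F : nat -> R) :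
  uniq s -> uniq t -> {subset t <= s} ->
  \prod_(p <- s) (if p \in t then F p else 1) = \prod_(p <- t) F p.
Proof.
move=> us ut ts; rewrite -big_mkcond -big_filter; apply: perm_big.
rewrite uniq_perm ?filter_uniq // => p; rewrite mem_filter.
by apply/andP/idP => [[]|pt] //; split=> //; apply: ts.
Qed.

Lemma rad_gt0 n : (0 < rad n)%N.
Proof.
by rewrite /rad big_seq prodn_cond_gt0 // => p; rewrite mem_primes => /andP[/prime_gt0].
Qed.

Lemma rad_le n : (0 < n)%N -> (rad n <= n)%N.
Proof.
move=> n0; rewrite /rad [leqRHS](prod_prime_decomp n0) prime_decompE big_map /=.
rewrite big_seq [leqRHS]big_seq; elim/big_ind2: _ => // [a b c d|p]; first exact: leq_mul.
move=> pn; rewrite -[leqLHS]expn1 leq_exp2l; last first.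
  by move: pn; rewrite mem_primes => /andP[/prime_gt1].
by rewrite logn_gt0.
Qed.

Lemma eq_rad m n : primes m =i primes n -> rad m = rad n.
Proof. by move=> mn; apply: perm_big; rewrite uniq_perm ?primes_uniq. Qed.

(** [rad q == q] says that [q] is squarefree. The primes 2 and 3 are left out because p - 2 vanishes
    at 2 and the weight at 3 would be 2, whereas the product of weight and sieving function is to
    stay in [-1, 1]. *)
Definition sieving_modulus (d q : nat) : bool :=
  (rad q == q) && all (fun p => (4 < p)%N && ~~ (p %| d)%N) (primes q).

Definition weight (R : realFieldType) (q : nat) : R :=
  \prod_(p <- primes q) sieving_weight R p.

Definition sieving_prod (R : realFieldType) (d q n : nat) : R :=
  \prod_(p <- primes q) sieving_fun R d p n.

Definition weight_sum (R : realFieldType) (d z : nat) : R :=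
  \sum_(1 <= q < z.+1 | sieving_modulus d q) weight R q.

Lemma weight_gt0 (R : realFieldType) d q : sieving_modulus d q -> 0 < weight R q.
Proof.
move=> /andP[_ /allP Q]; rewrite /weight big_seq; apply: prodr_gt0 => p /Q /andP[p4 _].
exact: sieving_weight_gt0.
Qed.

Lemma norm_weight_sieving_prod (R : realFieldType) d q n : sieving_modulus d q ->
  `|weight R q * sieving_prod R d q n| <= 1.
Proof.
move=> /andP[_ /allP Q]; rewrite /weight /sieving_prod -big_split /= normr_prod.
rewrite big_seq; apply: prodr_ile1 => p /Q /andP[p4 _].
have w0 := sieving_weight_gt0 R p p4; rewrite normr_ge0 /= /sieving_fun; case: ifP => _.
  by rewrite mulrN divff ?normrN1 // gt_eqF.
by rewrite mulr1 gtr0_norm // sieving_weight_le1.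
Qed.

(** The product splits over the primes of q q'. A prime dividing only one modulus contributes its
    mean 0; when q = q' every prime contributes its mean square, the inverse of its weight. The
    summand is at most 1, so the error is at most the period, which is at most q q' <= z ^ 2. *)
Lemma sum_sieving_prod_le (R : realFieldType) d X z q q' :
  sieving_modulus d q -> sieving_modulus d q' -> (0 < q <= z)%N -> (0 < q' <= z)%N ->
  \sum_(n < X) (weight R q * sieving_prod R d q n) * (weight R q' * sieving_prod R d q' n)
   <= (if q == q' then X%:R * weight R q else 0) + (z ^ 2)%:R.
Proof.
move=> Q Q' /andP[q0 qz] /andP[q'0 q'z].
pose s := primes (q * q'); pose M := rad (q * q').
have ms p : (p \in s) = (p \in primes q) || (p \in primes q').
  by rewrite primesM.
have big4 p : p \in s -> [/\ prime p, (4 < p)%N & ~~ (p %| d)%N].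
  move=> ps; split; first by move: ps; rewrite mem_primes => /andP[].
    by move: ps; rewrite ms => /orP[]; [case/andP: Q|case/andP: Q'];
       move=> _ /allP H /H /andP[].
  by move: ps; rewrite ms => /orP[]; [case/andP: Q|case/andP: Q'];
     move=> _ /allP H /H /andP[].
pose g p n : R := (if p \in primes q then sieving_fun R d p n else 1) *
                  (if p \in primes q' then sieving_fun R d p n else 1).
have gE n : sieving_prod R d q n * sieving_prod R d q' n = \prod_(p <- s) g p n.
  rewrite /g big_split /= !prod_subseq ?primes_uniq // => p;
  by rewrite ms => ->; rewrite ?orbT.
have gper p : periodic p (g p).
  by move=> n; rewrite /g !sieving_fun_periodic.
pose G n := (weight R q * sieving_prod R d q n) * (weight R q' * sieving_prod R d q' n).
have GE n : G n = weight R q * weight R q' * \prod_(p <- s) g p n.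
  by rewrite /G mulrACA gE.
have Gper : periodic M G.
  move=> n; rewrite !GE; congr (_ * _); apply: eq_big_seq => p ps.
  have /dvdnP[k ->] : (p %| M)%N by rewrite /M /rad (big_rem p) //= dvdn_mulr.
  by elim: k => [|k IHk]; rewrite ?addn0 // mulSn addnCA addnC gper.
have M0 : (0 < M)%N := rad_gt0 _.
have G1 n : G n <= 1.
  apply: le_trans (ler_norm _) _; rewrite normrM -[leRHS]mulr1.
  by apply: ler_pM => //; apply: norm_weight_sieving_prod.
apply: (le_trans (sum_periodic_le _ _ X _ M0 Gper G1)); apply: lerD; last first.
  rewrite ler_nat; apply: leq_trans (rad_le _ _) _; first by rewrite muln_gt0 q0.
  by rewrite expnS expn1 leq_mul.
under eq_bigr do rewrite GE.
rewrite -mulr_sumr sum_prod_primes; first last.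
- by move=> p _; apply: gper.
- by apply/allP => p /big4[].
- exact: primes_uniq.
have [qq'|qq'] := eqVneq q q'.
  have -> : \prod_(p <- s) \sum_(r < p) g p r = M%:R / weight R q.
    rewrite /M /rad /weight natr_prod; rewrite -/s.
    have -> : \prod_(p <- primes q) sieving_weight R p = \prod_(p <- s) sieving_weight R p.
      by apply: perm_big; rewrite uniq_perm ?primes_uniq // => p; rewrite ms qq' orbb.
    rewrite -prodf_div; apply: eq_big_seq => p ps.
    have [pp p4 pd] := big4 p ps.
    rewrite -(sum_sieving_fun_sqr R d) //; apply: eq_bigr => r _.
    by move: ps; rewrite /g ms -qq' orbb => ->.
  have w0 := weight_gt0 R d q Q.
  have -> : (X %/ M)%:R * (weight R q * weight R q' * (M%:R / weight R q)) =
           (X %/ M * M)%:R * weight R q.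
    by rewrite -qq' natrM; field; rewrite gt_eqF.
  by apply: ler_wpM2r; rewrite ?ler_nat ?leq_divM // ltW.
suff [p ps p0] : exists2 p, p \in s & \sum_(r < p) g p r = 0.
  by rewrite (big_rem p) //= p0 mul0r mulr0 mulr0.
(* Squarefree numbers with the same primes are equal, so distinct moduli differ at some prime. *)
have [/hasP[p ps pP]|/hasPn H] :=
    boolP (has (fun p => (p \in primes q) != (p \in primes q')) s).
  exists p => //; have [pp p4 pd] := big4 p ps.
  rewrite -[RHS](sum_sieving_fun R d p) //; apply: eq_bigr => r _; rewrite /g.
  by move: pP; case: (p \in primes q) (p \in primes q') => -[] //; rewrite ?mulr1 ?mul1r.
case/andP: Q => /eqP rq _; case/andP: Q' => /eqP rq' _.
case/eqP: qq'; rewrite -rq -rq'; apply: eq_rad => p.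
have := H p; rewrite ms negbK.
by case: (p \in primes q) (p \in primes q') => -[] // /(_ isT).
Qed.

(* Selberg's sieve in dual form.  The functions [sieving_prod d q] are orthogonal over a period, with
   mean square [1 / weight q], and equal to 1 on the sifted set; so the sum of [weight q * sieving_prod]
   is [weight_sum] on S and has second moment about [X * weight_sum]. *)
Lemma selberg_sieve (R : realFieldType) d X z (S : pred nat) :
  (forall n p, S n -> prime p -> (p <= z)%N -> ~~ (p %| n * (n + d))%N) ->
  (\sum_(n < X | S n) 1) * weight_sum R d z ^+ 2 <=
    X%:R * weight_sum R d z + (z ^ 4)%:R.
Proof.
move=> sifted; set J := weight_sum R d z.
pose F n := \sum_(1 <= q < z.+1 | sieving_modulus d q) weight R q * sieving_prod R d q n.
have FJ n : S n -> F n = J.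
  move=> Sn; rewrite /F /J /weight_sum big_nat_cond [RHS]big_nat_cond.
  apply: eq_bigr => q /andP[/andP[q0 qz] Q]; rewrite /sieving_prod.
  rewrite big_seq big1 ?mulr1 // => p; rewrite mem_primes => /and3P[pp _ pq].
  rewrite /sieving_fun ifN // sifted //.
  by apply: leq_trans (dvdn_leq q0 pq) _; rewrite -ltnS.
apply: (@le_trans _ _ (\sum_(n < X) F n ^+ 2)).
  rewrite mulr_suml big_mkcond; apply: ler_sum => n _.
  by case: ifP => [/FJ ->|_]; rewrite ?mul1r // sqr_ge0.
under eq_bigr do rewrite expr2 /F big_distrlr /=.
rewrite exchange_big /=.
under eq_bigr do rewrite exchange_big /=.
apply: (@le_trans _ _ (\sum_(1 <= q < z.+1 | sieving_modulus d q)
   \sum_(1 <= q' < z.+1 | sieving_modulus d q')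
     ((if q == q' then X%:R * weight R q else 0) + (z ^ 2)%:R))).
  rewrite big_nat_cond [leRHS]big_nat_cond; apply: ler_sum => q /andP[hq Q].
  rewrite big_nat_cond [leRHS]big_nat_cond; apply: ler_sum => q' /andP[hq' Q'].
  by apply: sum_sieving_prod_le.
under eq_bigr do rewrite big_split /=.
rewrite big_split /=; apply: lerD.
  rewrite mulr_sumr; apply: ler_sum => q Q.
  have w0 := weight_gt0 R d q Q.
  rewrite -big_mkcondr big_mkcond.
  have [qin|qin] := boolP (q \in index_iota 1 z.+1).
    rewrite (bigD1_seq q) ?iota_uniq //= Q eqxx big1 ?addr0 // => i.
    by rewrite eq_sym => /negbTE ->; rewrite andbF.
  rewrite big_seq big1 ?mulr_ge0 ?(ltW w0) // => i iin.
  by case: eqP => [qi|_]; [rewrite qi iin in qin | rewrite andbF].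
apply: (@le_trans _ _ (\sum_(1 <= q < z.+1) \sum_(1 <= q' < z.+1) (z ^ 2)%:R)).
  rewrite big_mkcond; apply: ler_sum => q _; case: ifP => _; last exact: sumr_ge0.
  by rewrite big_mkcond; apply: ler_sum => q' _; case: ifP.
rewrite !sumr_const_nat subn1 /= -!mulrnA ler_nat.
by rewrite !expnS; lia.
Qed.

(** * Radicals and lower bounds for the sum of the sieve weights *)

Lemma rad_dvd n : (0 < n)%N -> (rad n %| n)%N.
Proof.
move=> n0; rewrite /rad [X in (_ %| X)%N](prod_prime_decomp n0) prime_decompE big_map /=.
rewrite big_seq [X in (_ %| X)%N]big_seq.
elim/big_ind2: _ => // [a b c e|p pn]; first exact: dvdn_mul.
by rewrite -[X in (X %| _)%N]expn1 dvdn_exp2l // logn_gt0.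
Qed.

Lemma primes_rad n : (0 < n)%N -> primes (rad n) =i primes n.
Proof.
move=> n0 p; rewrite !mem_primes n0 rad_gt0 /=.
apply/andP/andP => -[pp pn]; split => //; first exact: dvdn_trans pn (rad_dvd _ n0).
have pin : p \in primes n by rewrite mem_primes pp n0.
by rewrite /rad (big_rem p) //= dvdn_mulr.
Qed.

Lemma rad_rad n : (0 < n)%N -> rad (rad n) = rad n.
Proof. by move=> n0; apply: eq_rad; apply: primes_rad. Qed.

Lemma rad_eq1 n : (0 < n)%N -> rad n = 1%N -> n = 1%N.
Proof.
move=> n0 r1; apply/eqP; rewrite eqn_leq n0 andbT leqNgt; apply/negP => n1.
have : pdiv n \in primes (rad n) by rewrite primes_rad // mem_primes pdiv_prime ?pdiv_dvd ?n0.
by rewrite r1.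
Qed.

Lemma perm_primes_mul p m : prime p -> (0 < m)%N -> ~~ (p %| m)%N ->
  perm_eq (primes (p * m)) (p :: primes m).
Proof.
move=> pp m0 pm; apply: uniq_perm; rewrite ?primes_uniq //=.
  by rewrite primes_uniq mem_primes (negbTE pm) !andbF.
by move=> q; rewrite primesM ?(prime_gt0 pp) // primes_prime // !inE.
Qed.

Lemma rad_prime_mul p m : prime p -> (0 < m)%N -> ~~ (p %| m)%N ->
  rad (p * m) = (p * rad m)%N.
Proof. by move=> pp m0 pm; rewrite /rad (perm_big _ (perm_primes_mul _ _ pp m0 pm)) big_cons. Qed.

Lemma rad_prime_dvd p m : prime p -> (0 < m)%N -> (p %| m)%N -> rad (p * m) = rad m.
Proof.
move=> pp m0 pm; apply: eq_rad => q; rewrite primesM ?(prime_gt0 pp) // primes_prime // inE.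
by case: eqP => // ->; rewrite mem_primes pp m0.
Qed.

Lemma weight_prime_mul (R : realFieldType) p m : prime p -> (0 < m)%N -> ~~ (p %| m)%N ->
  weight R (p * m) = sieving_weight R p * weight R m.
Proof. by move=> pp m0 pm; rewrite /weight (perm_big _ (perm_primes_mul _ _ pp m0 pm)) big_cons. Qed.

(** With rad(a b) = q as the condition [P], the square of a harmonic sum is cut into pieces indexed
    by [q], each of which turns out to be at most [weight q]. *)
Definition pair_sum (R : realFieldType) (y : nat) (P : pred nat) : R :=
  \sum_(1 <= a < y.+1) \sum_(1 <= b < y.+1 | P (a * b)%N) (a * b)%:R^-1.

Lemma pair_sum_dvd (R : realFieldType) y p (P Q : pred nat) : (0 < p)%N ->
  (forall m, (0 < m)%N -> P (p * m)%N -> Q m) ->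
  \sum_(1 <= a < y.+1 | (p %| a)%N) \sum_(1 <= b < y.+1 | P (a * b)%N) (a * b)%:R^-1
    <= p%:R^-1 * pair_sum R y Q.
Proof.
move=> p0 PQ.
rewrite (sum_multiples _ _ y (fun a => \sum_(1 <= b < y.+1 | P (a * b)%N) (a * b)%:R^-1)) //.
rewrite /pair_sum mulr_sumr.
rewrite [leRHS](big_cat_nat (n := (y %/ p).+1)) ?ltnS ?leq_div //=.
rewrite -[leLHS]addr0; apply: lerD; last first.
  apply: sumr_ge0 => a _; rewrite mulr_ge0 ?invr_ge0 //.
  by apply: sumr_ge0 => b _; rewrite invr_ge0.
rewrite big_nat [leRHS]big_nat; apply: ler_sum => a /andP[a0 _].
rewrite mulr_sumr big_mkcond [leRHS]big_mkcond big_nat [leRHS]big_nat.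
apply: ler_sum => b /andP[b0 _]; rewrite -mulnA; case: ifP => [H|_].
  by rewrite (PQ _ _ H) ?muln_gt0 ?a0 // natrM invfM.
by case: ifP => // _; rewrite mulr_ge0 ?invr_ge0.
Qed.

(* Let p divide q and m = q / p.  A pair with radical q has p dividing a or b, and dividing that entry
   by p leaves a pair with radical m or q.  Hence K(q) <= (2 / p) (K(m) + K(q)), that is
   K(q) <= 2 / (p - 2) * K(m). *)
Lemma pair_sum_rad_le (R : realFieldType) d y q : (0 < q)%N -> sieving_modulus d q ->
  pair_sum R y (fun m => rad m == q) <= weight R q.
Proof.
elim: q {-2}q (leqnn q) => [|n IH] q; first by rewrite leqn0 => /eqP ->.
move=> qn q0 Q.
have [q1|q1] := leqP q 1.
  have {qn q0 q1 Q} -> : q = 1%N by lia.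
  rewrite /weight big_nil /pair_sum.
  have E a b : (0 < a)%N -> (0 < b)%N -> (rad (a * b) == 1%N) = (a == 1%N) && (b == 1%N).
    move=> a0 b0; rewrite -muln_eq1; apply/eqP/eqP => [/rad_eq1 -> //|->].
      by rewrite muln_gt0 a0.
    by rewrite /rad big_nil.
  case: y {IH} => [|y]; first by rewrite big_nil.
  rewrite big_ltn // [X in _ + X]big_nat [X in _ + X]big1 ?addr0; last first.
    move=> a /andP[a1 _]; rewrite big_nat_cond big1 // => b /andP[/andP[b0 _]].
    rewrite E // ?(ltnW a1) //; case: eqP a1 => // ->; by rewrite ltnn.
  rewrite big_mkcond big_ltn // big_nat big1 ?addr0.
    by rewrite E //= muln1 invr1.
  move=> b /andP[b1 _]; rewrite E // ?(ltnW b1) //=; case: eqP b1 => // ->; by rewrite ltnn.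
set p := pdiv q; have pp : prime p := pdiv_prime q1; have pq : (p %| q)%N := pdiv_dvd q.
case/dvdnP: pq => m; rewrite mulnC => qE.
have m0 : (0 < m)%N by move: q0; rewrite qE muln_gt0 => /andP[].
have mq : (m < q)%N by rewrite qE ltn_Pmull // prime_gt1.
case/andP: (Q) => /eqP rq /allP Qall.
have pm : ~~ (p %| m)%N.
  apply/negP => pm; have := rad_le _ m0.
  by rewrite -(rad_prime_dvd p) // -qE rq leqNgt mq.
have rm : rad m = m.
  apply/eqP; move: rq; rewrite qE rad_prime_mul // => /eqP.
  by rewrite eqn_pmul2l // prime_gt0.
have Qm : sieving_modulus d m.
  rewrite /sieving_modulus rm eqxx; apply/allP => r rin; apply: Qall.
  by rewrite qE primesM ?(prime_gt0 pp) // rin orbT.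
have /andP[p4 pd] : (4 < p)%N && ~~ (p %| d)%N.
  by apply: Qall; rewrite qE primesM ?(prime_gt0 pp) // primes_prime // inE eqxx.
have Km := IH m (leq_trans mq qn) m0 Qm.
rewrite qE weight_prime_mul //.
set K := pair_sum R y (fun k => rad k == (p * m)%N).
set L := pair_sum R y (fun k => rad k == m) in Km *.
set T := pair_sum R y (fun k => (rad k == m) || (rad k == p * m)%N).
have TE : T = L + K.
  rewrite /T /L /K /pair_sum -big_split; apply: eq_bigr => a _ /=.
  rewrite !(big_mkcond (fun b => rad _ == _)) -big_split big_mkcond /=.
  apply: eq_bigr => b _; case: eqP => [->|_] /=; last by rewrite add0r.
  have -> : (m == p * m)%N = false by apply/negbTE; rewrite neq_ltn -qE mq.
  by rewrite addr0.
have half : \sum_(1 <= a < y.+1 | (p %| a)%N)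
    \sum_(1 <= b < y.+1 | rad (a * b) == (p * m)%N) (a * b)%:R^-1 <= p%:R^-1 * T.
  apply: (pair_sum_dvd _ _ _ (fun k => rad k == (p * m)%N)); first exact: prime_gt0.
  move=> k k0 /eqP; have [pk|pk] := boolP (p %| k)%N.
    by rewrite rad_prime_dvd // => ->; rewrite eqxx orbT.
  rewrite rad_prime_mul // => /eqP; rewrite eqn_pmul2l ?(prime_gt0 pp) // => ->.
  by [].
have KT : K <= (p%:R^-1 * T) *+ 2.
  rewrite mulr2n; apply: le_trans (lerD half half).
  (* The second copy is read with [a] and [b] exchanged, so that it counts the pairs in which [p]
     divides [b]. *)
  rewrite {2}(_ : \sum_(1 <= a < y.+1 | (p %| a)%N) _ = \sum_(1 <= a < y.+1)
    \sum_(1 <= b < y.+1 | (rad (a * b) == (p * m)%N) && (p %| b)%N) (a * b)%:R^-1); last first.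
    rewrite big_mkcond [RHS](eq_bigr (fun a => \sum_(1 <= b < y.+1)
      if (p %| b)%N && (rad (a * b) == (p * m)%N) then (a * b)%:R^-1 else 0)); last first.
      by move=> a _; rewrite big_mkcond; apply: eq_bigr => b _; rewrite andbC.
    rewrite exchange_big /=; apply: eq_bigr => a _; case: ifP => pa.
      by rewrite big_mkcond; apply: eq_bigr => b _; rewrite mulnC.
    by rewrite big1.
  rewrite /K /pair_sum [X in _ <= X + _]big_mkcond -big_split [leLHS]big_nat [leRHS]big_nat /=.
  apply: ler_sum => a /andP[a0 _].
  have [pa|pa] := boolP (p %| a)%N.
    by rewrite lerDl; apply: sumr_ge0 => b _; rewrite invr_ge0.
  rewrite add0r big_mkcond [leRHS]big_mkcond big_nat [leRHS]big_nat.
  apply: ler_sum => b /andP[b0 _]; case: eqP => //= rab.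
  have : (p %| a * b)%N.
    apply: dvdn_trans (rad_dvd _ _); last by rewrite muln_gt0 a0.
    by rewrite rab dvdn_mulr.
  by rewrite Euclid_dvdM // (negbTE pa) /= => ->.
have p4' : 4%:R < p%:R :> R by rewrite ltr_nat.
have p0 : 0 < p%:R :> R by lra.
have : K * p%:R <= (L + K) *+ 2.
  have -> : (L + K) *+ 2 = (p%:R^-1 * T) *+ 2 * p%:R.
    by rewrite TE; field; rewrite gt_eqF.
  by rewrite ler_pM2r.
rewrite /sieving_weight mulrAC ler_pdivlMr; lra.
Qed.

Definition harmonic_coprime (R : realFieldType) (B : seq nat) (y : nat) : R :=
  \sum_(1 <= a < y.+1 | all (fun p => ~~ (p %| a)%N) B) a%:R^-1.

(** For [a] and [b] coprime to 6 d, the radical of a b is a sieving modulus not exceeding y ^ 2.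
    Grouping the pairs of the expanded square by this radical compares it with the weights. *)
Lemma weight_sum_ge (R : realFieldType) d y : (0 < d)%N ->
  harmonic_coprime R [:: 2%N, 3%N & primes d] y ^+ 2 <= weight_sum R d (y ^ 2).
Proof.
move=> d0; set B := [:: 2%N, 3%N & primes d].
pose ok a := all (fun p => ~~ (p %| a)%N) B.
have okQ a b : (0 < a)%N -> (0 < b)%N -> ok a -> ok b -> sieving_modulus d (rad (a * b)).
  move=> a0 b0 /allP oka /allP okb; have ab0 : (0 < a * b)%N by rewrite muln_gt0 a0.
  rewrite /sieving_modulus rad_rad // eqxx; apply/allP => p.
  rewrite primes_rad // mem_primes => /and3P[pp _].
  rewrite Euclid_dvdM // => pab.
  have pB : p \notin B.
    apply/negP => pB; move: pab; apply/negP; rewrite negb_or.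
    by rewrite (oka p pB) (okb p pB).
  move: pB; rewrite !inE !negb_or mem_primes pp d0 /= => /and3P[p2 p3 ->].
  by case: p pp p2 p3 {pab} => [|[|[|[|[|p]]]]].
rewrite expr2 (_ : harmonic_coprime R B y = \sum_(1 <= a < y.+1 | ok a) a%:R^-1) // big_distrlr /=.
apply: (@le_trans _ _ (\sum_(1 <= q < (y ^ 2).+1 | sieving_modulus d q)
    pair_sum R y (fun m => rad m == q))); last first.
  rewrite /weight_sum big_nat_cond [leRHS]big_nat_cond.
  by apply: ler_sum => q /andP[/andP[q0 _] Q]; exact: (pair_sum_rad_le _ d).
rewrite /pair_sum [leRHS]exchange_big /= [leLHS]big_mkcond [leLHS]big_nat [leRHS]big_nat.
apply: ler_sum => a /andP[a0 ay].
under [leRHS]eq_bigr do rewrite big_mkcond.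
rewrite [leRHS]exchange_big /=; case: ifP => oka; last first.
  by apply: sumr_ge0 => b _; apply: sumr_ge0 => q _; case: ifP; rewrite ?invr_ge0.
rewrite [leLHS]big_mkcond [leLHS]big_nat [leRHS]big_nat.
apply: ler_sum => b /andP[b0 lby].
case: ifP => okb; last by apply: sumr_ge0 => q _; case: ifP; rewrite ?invr_ge0.
have ab0 : (0 < a * b)%N by rewrite muln_gt0 a0.
rewrite -invfM -natrM.
rewrite big_mkcond (bigD1_seq (rad (a * b))) ?iota_uniq //=; last first.
  rewrite mem_index_iota rad_gt0 ltnS /=; apply: leq_trans (rad_le _ ab0) _.
  by rewrite expnS expn1 leq_mul.
rewrite eqxx okQ // lerDl; apply: sumr_ge0 => q _.
by case: ifP => // _; case: ifP; rewrite ?invr_ge0.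
Qed.

(** The conditions in [B] are imposed one at a time. If a multiple p a satisfies those already
    imposed, so does a, and a <= y / p; hence the terms removed make up at most 1 / p of the
    whole. *)
Lemma harmonic_coprime_ge (R : realFieldType) (B : seq nat) y :
  all (fun p => 0 < p)%N B ->
  (\prod_(p <- B) (1 - p%:R^-1)) * harmonic_coprime R [::] y <= harmonic_coprime R B y.
Proof.
elim: B => [|p B IH] /=; first by rewrite big_nil mul1r.
move=> /andP[p0 /IH {}IH]; rewrite big_cons -mulrA.
have p1 : p%:R^-1 <= 1 :> R by rewrite invf_le1 ?ler1n ?ltr0n.
apply: (@le_trans _ _ ((1 - p%:R^-1) * harmonic_coprime R B y)).
  by apply: ler_wpM2l; rewrite ?subr_ge0.
have E : harmonic_coprime R B y = harmonic_coprime R (p :: B) y +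
    \sum_(1 <= a < y.+1 | (p %| a)%N)
      if all (fun p => ~~ (p %| a)%N) B then a%:R^-1 else 0.
  rewrite /harmonic_coprime !(big_mkcond (fun a => all _ _)) (big_mkcond (fun a => p %| a)%N).
  rewrite -big_split; apply: eq_bigr => a _ /=.
  by case: (p %| a)%N => /=; rewrite ?add0r ?addr0.
rewrite mulrBl mul1r lerBlDr {1}E lerD2l.
rewrite (sum_multiples _ _ _ (fun a => if all (fun p => ~~ (p %| a)%N) B then a%:R^-1 else 0)) //.
rewrite /harmonic_coprime mulr_sumr [leRHS]big_mkcond.
rewrite [leRHS](big_cat_nat (n := (y %/ p).+1)) ?ltnS ?leq_div //=.
rewrite -[leLHS]addr0; apply: lerD; last first.
  by apply: sumr_ge0 => a _; case: ifP; rewrite // mulr_ge0 ?invr_ge0.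
apply: ler_sum => a _; case: ifP => [/allP H|_].
  rewrite ifT ?natrM ?invfM //; apply/allP => q /H; apply: contra => qa.
  exact: dvdn_mull.
by case: ifP => // _; rewrite mulr_ge0 ?invr_ge0.
Qed.

Lemma harmonic_ge_ln (R : realType) y : ln y.+1%:R <= harmonic_coprime R [::] y.
Proof.
elim: y => [|y IH]; first by rewrite ln1 /harmonic_coprime big_nil.
rewrite /harmonic_coprime big_nat_recr //=.
have -> : y.+2%:R = y.+1%:R * (1 + y.+1%:R^-1) :> R.
  by rewrite mulrDr mulr1 divff // natr1.
rewrite lnM ?posrE ?ltr0Sn // ?ltr_wpDl // lerD //.
by apply: le_ln1Dx; apply: lt_le_trans (_ : 0 <= _); rewrite ?invr_ge0 // oppr_lt0.
Qed.

(** Euler's phi(d) / d, as the product that the sieve produces; [phi_ratio_totient] makes the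
    link. *)
Definition phi_ratio (R : realFieldType) (d : nat) : R :=
  \prod_(p <- primes d) (1 - p%:R^-1).

(** The 1/3 is (1 - 1/2) (1 - 1/3). If 2 or 3 divides [d], its factor is counted twice, which only
    lowers the bound. *)
Lemma weight_sum_ge_ln (R : realType) d y : (0 < d)%N ->
  (phi_ratio R d * ln y.+1%:R / 3) ^+ 2 <= weight_sum R d (y ^ 2).
Proof.
move=> d0; apply: le_trans (weight_sum_ge R d y d0).
have r0 : 0 <= phi_ratio R d.
  rewrite /phi_ratio big_seq; apply: prodr_ge0 => p; rewrite mem_primes => /andP[/prime_gt0 p0 _].
  by rewrite subr_ge0 invf_le1 ?ler1n ?ltr0n.
rewrite ler_sqr ?nnegrE; first last.
- by apply: sumr_ge0 => a _; rewrite invr_ge0.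
- by rewrite !mulr_ge0 ?invr_ge0 ?ln_ge0 ?ler1n.
apply: le_trans (harmonic_coprime_ge _ _ _ _); last first.
  by apply/allP => p; rewrite !inE mem_primes => /or3P[/eqP ->|/eqP ->|/andP[/prime_gt0]].
rewrite !big_cons -/(phi_ratio R d).
have -> : (1 - 2%:R^-1) * ((1 - 3%:R^-1) * phi_ratio R d) = phi_ratio R d / 3 :> R by field.
rewrite mulrAC; apply: ler_wpM2l; last exact: harmonic_ge_ln.
by rewrite mulr_ge0 ?invr_ge0.
Qed.

Lemma phi_ratio_gt0 (R : realFieldType) d : 0 < phi_ratio R d.
Proof.
rewrite /phi_ratio big_seq; apply: prodr_gt0 => p; rewrite mem_primes => /andP[/prime_gt1 p1 _].
by rewrite subr_gt0 invf_lt1 ?ltr1n ?ltr0n // ltnW.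
Qed.

Lemma phi_ratio_le1 (R : realFieldType) d : phi_ratio R d <= 1.
Proof.
rewrite /phi_ratio big_seq; apply: prodr_ile1 => p; rewrite mem_primes => /andP[/prime_gt0 p0 _].
by rewrite subr_ge0 gerBl invr_ge0 ler0n andbT invf_le1 ?ler1n ?ltr0n.
Qed.

Lemma ex_root (k X : nat) : (0 < k)%N -> exists y, (y ^ k <= X < y.+1 ^ k)%N.
Proof.
move=> k0; elim: X => [|X [y /andP[y1 y2]]]; first by exists 0%N; rewrite exp0n // exp1n.
have [h|h] := ltnP X.+1 (y.+1 ^ k); first by exists y; rewrite h ltnW ?ltnS.
exists y.+1; rewrite h /=; apply: leq_ltn_trans (_ : y.+1 ^ k < _)%N; first exact: y2.
by rewrite ltn_exp2r.
Qed.

(** * Prime pairs with a given difference *)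

Definition prime_pairs (X d : nat) : nat := \sum_(n < X) (prime n && prime (n + d)).

(* 2187 = 3 * 9 * 9 ^ 2: the sieve gives 3 X / J with J >= (phi_ratio d * ln y / 3) ^ 2, and X < (y + 1) ^ 9. *)
Lemma prime_pairs_le (R : realType) X d : (0 < d)%N -> (1 < X)%N ->
  (prime_pairs X d)%:R <= 2187%:R * X%:R / ln X%:R ^+ 2 * phi_ratio R d ^- 2 :> R.
Proof.
move=> d0 X1.
(* The sieve runs to level z = y ^ 2. Its error z ^ 4 = y ^ 8 is at most X and, since J >= 1, is
   absorbed by the main term X J. *)
have [//|y /andP[y9 X9]] := ex_root 9 X.
have y0 : (0 < y)%N by case: y y9 X9 => // _; rewrite exp1n; case: (X) X1 => [|[]].
set L : R := ln y.+1%:R; set r := phi_ratio R d.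
have L0 : 0 < L by rewrite ln_gt0 // ltr1n.
have r0 : 0 < r := phi_ratio_gt0 R d.
have lX0 : 0 < ln X%:R :> R by rewrite ln_gt0 // ltr1n.
have X0 : 0 < X%:R :> R by rewrite ltr0n ltnW.
have LX : ln X%:R <= L *+ 9.
  by rewrite -lnXn ?ltr0Sn // ler_ln ?posrE ?exprn_gt0 // -natrX ler_nat ltnW.
set J0 : R := (r * L / 3) ^+ 2.
have J00 : 0 < J0 by rewrite exprn_gt0 // !mulr_gt0 // invr_gt0.
have JJ := weight_sum_ge_ln R d y d0; rewrite -/r -/L -/J0 in JJ.
set J := weight_sum R d (y ^ 2) in JJ.
have J1 : 1 <= J.
  rewrite /J /weight_sum big_mkcond big_ltn ?ltnS ?expn_gt0 ?y0 //.
  rewrite /sieving_modulus /rad /weight !big_nil /= lerDl; apply: sumr_ge0 => q _.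
  by case: ifP => // Q; apply/ltW/(weight_gt0 R d).
(* A prime n <= y ^ 2 is struck out by itself. These n are set aside and counted trivially, at most
   y ^ 2 + 1 of them; [small] compares this with X / J0. *)
pose S n := [&& prime n, prime (n + d) & (y ^ 2 < n)%N].
have sieve := selberg_sieve R d X (y ^ 2) S.
have SJ : (\sum_(n < X | S n) 1) <= 2 * X%:R / J0 :> R.
  have /sieve {}sieve n p : S n -> prime p -> (p <= y ^ 2)%N -> ~~ (p %| n * (n + d))%N.
    case/and3P=> pn pnd yn pp py; rewrite Euclid_dvdM // !dvdn_prime2 // negb_or.
    have pltn := leq_ltn_trans py yn.
    by rewrite !ltn_eqF // (leq_trans pltn) ?leq_addr.
  apply: (@le_trans _ _ (2 * X%:R / J)); last first.
    by rewrite ler_pM2l ?mulr_gt0 // lef_pV2 ?posrE // (lt_le_trans J00).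
  have Jp : 0 < J by apply: lt_le_trans J1.
  rewrite ler_pdivlMr // -(ler_pM2r Jp) -mulrA -expr2; apply: le_trans sieve _.
  rewrite -expnM (_ : (2 * 4 = 8)%N) // -/J.
  have : (y ^ 8)%:R <= X%:R * J.
    rewrite -[leLHS]mulr1; apply: ler_pM => //; rewrite ler_nat.
    by apply: leq_trans y9; rewrite leq_pexp2l.
  lra.
have small : (y ^ 2).+1%:R <= X%:R / J0 :> R.
  have Ly : L <= y%:R.
    by rewrite /L -natr1 addrC le_ln1Dx // (lt_le_trans _ (ler0n _ _)) // oppr_lt0.
  have Jy : J0 <= (y ^ 2)%:R / 9%:R.
    have -> : (y ^ 2)%:R / 9%:R = (y%:R / 3) ^+ 2 :> R by rewrite natrX; field.
    rewrite /J0 ler_sqr ?nnegrE ?divr_ge0 ?mulr_ge0 ?(ltW r0) ?(ltW L0) //.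
    rewrite ler_pM2r ?invr_gt0 //.
    apply: le_trans Ly; rewrite -[leRHS]mul1r ler_pM2r //; exact: phi_ratio_le1.
  rewrite ler_pdivlMr //; apply: (@le_trans _ _ ((y ^ 2).+1%:R * ((y ^ 2)%:R / 9%:R))).
    by apply: ler_wpM2l.
  rewrite mulrA ler_pdivrMr // -!natrM ler_nat.
  have y2 : (y ^ 2 <= y ^ 4)%N by rewrite leq_pexp2l.
  have y4 : (y ^ 4 <= X)%N by apply: leq_trans y9; rewrite leq_pexp2l.
  rewrite mulSn -expnD; move: (y ^ 2)%N (y ^ (2 + 2))%N y2 y4 => a b; clear; lia.
have split_pairs : (prime_pairs X d)%:R <= (\sum_(n < X | S n) 1) + (y ^ 2).+1%:R :> R.
  apply: (@le_trans _ _ (\sum_(n < X) ((S n)%:R + (n < (y ^ 2).+1)%N%:R))).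
    rewrite /prime_pairs natr_sum; apply: ler_sum => n _; rewrite /S -natrD ler_nat.
    by case: (prime n) => //; case: (prime (n + d)) => //=; rewrite ltnS (leqNgt n); case: (_ < n)%N.
  rewrite big_split /=; apply: lerD.
    by rewrite [leRHS]big_mkcond; apply: ler_sum => n _; case: (S n).
  rewrite -natr_sum ler_nat -(big_mkord xpredT (fun n => (n < (y ^ 2).+1)%N : nat)).
  have [Xy|Xy] := leqP X (y ^ 2).+1.
    apply: leq_trans Xy; rewrite -[leqRHS]subn0 -[leqRHS]muln1 -sum_nat_const_nat.
    by apply: leq_sum => n _; case: (_ < _)%N.
  rewrite (big_cat_nat (n := (y ^ 2).+1)) ?(ltnW Xy) //= [X in (_ + X <= _)%N]big_nat.
  rewrite [X in (_ + X <= _)%N]big1 ?addn0; last by move=> n /andP[h _]; rewrite ltnS leqNgt h.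
  rewrite -[leqRHS]subn0 -[leqRHS]muln1 -sum_nat_const_nat.
  by apply: leq_sum => n _; case: (_ < _)%N.
apply: (le_trans split_pairs); apply: (@le_trans _ _ (3 * X%:R / J0)).
  have -> : 3 * X%:R / J0 = 2 * X%:R / J0 + X%:R / J0 by field; rewrite gt_eqF.
  exact: lerD.
have -> : 2187 * X%:R / ln X%:R ^+ 2 * r ^- 2 = 27 * X%:R / (r ^+ 2 * (ln X%:R / 9) ^+ 2).
  by field; rewrite !gt_eqF.
have -> : 3 * X%:R / J0 = 27 * X%:R / (r ^+ 2 * L ^+ 2).
  by rewrite /J0; field; rewrite !gt_eqF.
have l9 : 0 < ln X%:R / 9%:R :> R by rewrite divr_gt0.
rewrite ler_pM2l ?mulr_gt0 // lef_pV2 ?posrE ?mulr_gt0 ?exprn_gt0 //.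
rewrite ler_pM2l ?exprn_gt0 // ler_sqr ?nnegrE ?(ltW l9) ?(ltW L0) //.
by rewrite ler_pdivrMr // mulr_natr.
Qed.

(** * Prime differences have positive density *)

(** The factor at [p] is 1, plus [u] on the multiples of [p], where u <= 24 / p because (1 - x) ^- 3
    <= 1 + 24 x for 0 <= x <= 1/2. The other factors do not change when d is multiplied by [p], so
    the induction hypothesis applies to the multiples with Y / p in place of [Y], and the two parts
    combine to 1 + 24 / p ^ 2. *)
Lemma sum_local_factors_le (R : realFieldType) (B : seq nat) (Y : nat) :
  uniq B -> all prime B ->
  \sum_(1 <= d < Y.+1) \prod_(p <- B) (if (p %| d)%N then (1 - p%:R^-1) ^- 3 else 1 : R)
    <= (\prod_(p <- B) (1 + 24 / p%:R ^+ 2)) * Y%:R.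
Proof.
elim: B Y => [|p B IH] Y.
  by rewrite big_nil mul1r; under eq_bigr do rewrite big_nil;
     rewrite sumr_const_nat subn1.
move=> /= /andP[pB uB] /andP[pp aB]; rewrite big_cons.
set l := fun d => \prod_(p <- B) (if (p %| d)%N then (1 - p%:R^-1) ^- 3 else 1 : R).
have lE a : l (p * a)%N = l a.
  apply: eq_big_seq => q qB; have qp := allP aB q qB.
  rewrite Euclid_dvdM // dvdn_prime2 //; case: eqP => // qE.
  by rewrite -qE qB in pB.
have p2 : 2%:R <= p%:R :> R by rewrite ler_nat prime_gt1.
set u : R := (1 - p%:R^-1) ^- 3 - 1.
have -> : \sum_(1 <= d < Y.+1) \prod_(q <- p :: B)
    (if (q %| d)%N then (1 - q%:R^-1) ^- 3 else 1 : R) =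
    \sum_(1 <= d < Y.+1) l d + u * \sum_(1 <= d < (Y %/ p).+1) l d.
  rewrite -[X in u * X](eq_bigr _ (fun a _ => lE a)) -sum_multiples ?prime_gt0 //.
  rewrite mulr_sumr [X in _ + X]big_mkcond -big_split; apply: eq_bigr => d _ /=.
  by rewrite big_cons -/(l d) /u; case: ifP => _; ring.
set P := \prod_(q <- B) (1 + 24 / q%:R ^+ 2).
have P0 : 0 <= P.
  by apply: prodr_ge0 => q _; rewrite addr_ge0 // divr_ge0 // exprn_ge0.
have x1 : p%:R^-1 <= 2%:R^-1 :> R by rewrite lef_pV2 ?posrE //; lra.
have x0 : 0 < p%:R^-1 :> R by rewrite invr_gt0; lra.
have u24 : 0 <= u <= 24 / p%:R.
  rewrite /u; move: x0 x1; set x : R := p%:R^-1 => x0 x1.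
  have y0 : 0 < 1 - x by lra.
  have y3 : 0 < (1 - x) ^+ 3 by rewrite exprn_gt0.
  apply/andP; split.
    by rewrite subr_ge0 invf_ge1 // exprn_ile1 ?(ltW y0) //; lra.
  rewrite lerBlDr -[leLHS]div1r ler_pdivrMr //.
  have -> : (24 * x + 1) * (1 - x) ^+ 3 =
      1 + x * (21 - 69 * x + 59 * x ^+ 2 + 24 * x ^+ 2 * (2^-1 - x)) by field.
  rewrite lerDl mulr_ge0 ?(ltW x0) // addr_ge0 //; first by nra.
  by apply: mulr_ge0; [apply: mulr_ge0; rewrite ?sqr_ge0 | lra].
case/andP: u24 => u0 u24; have Yp := IH (Y %/ p)%N uB aB; have YY := IH Y uB aB.
have -> : (1 + 24 / p%:R ^+ 2) * P * Y%:R =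
    P * Y%:R + 24 / p%:R * (P * (Y%:R / p%:R)).
  by field; rewrite pnatr_eq0 -lt0n prime_gt0.
apply: lerD; first exact: YY.
apply: ler_pM => //; first by apply: sumr_ge0 => d _; apply: prodr_ge0 => q _;
    case: ifP => // _; rewrite invr_ge0 exprn_ge0 // subr_ge0; case: q => [|q];
    rewrite ?invr0 // invf_le1 ?ler1n.
apply: (le_trans Yp); rewrite ler_wpM2l // ler_pdivlMr ?(lt_le_trans _ p2) //.
by rewrite -natrM ler_nat leq_divM.
Qed.

Lemma sum_inv_sqr_le (R : realFieldType) Y :
  \sum_(1 <= n < Y.+2) n%:R ^- 2 <= 2 - Y.+1%:R^-1 :> R.
Proof.
elim: Y => [|Y IH]; first by rewrite big_nat1 expr1n; lra.
rewrite big_nat_recr //=; apply: (le_trans (lerD IH (lexx _))).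
have y0 : 0 < Y.+1%:R :> R by rewrite ltr0Sn.
have -> : Y.+2%:R = Y.+1%:R + 1 :> R by rewrite -natr1.
move: y0; set y : R := Y.+1%:R => y0.
have -> : 2 - (y + 1)^-1 = 2 - y^-1 + (y * (y + 1))^-1 by field; rewrite !gt_eqF; lra.
rewrite lerD2l lef_pV2 ?posrE ?mulr_gt0 ?exprn_gt0 //; nra.
Qed.

(** The product of the 1 + 24 / p ^ 2 is at most the exponential of 24 times the sum of the inverse
    squares, and that sum is at most 2. *)
Lemma sum_phi_ratio_le (R : realType) :
  exists2 C : R, 0 < C & forall Y, \sum_(1 <= d < Y.+1) phi_ratio R d ^- 3 <= C * Y%:R.
Proof.
exists (expR 48); first exact: expR_gt0.
case=> [|Y]; first by rewrite big_nil mulr0.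
set B := [seq p <- index_iota 1 Y.+2 | prime p].
have uB : uniq B by rewrite filter_uniq ?iota_uniq.
have aB : all prime B by apply: filter_all.
apply: le_trans (_ : _ <= (\prod_(p <- B) (1 + 24 / p%:R ^+ 2)) * Y.+1%:R) _.
  apply: le_trans (sum_local_factors_le R B Y.+1 uB aB).
  rewrite big_nat [leRHS]big_nat; apply: ler_sum => d /andP[d0 dY].
  rewrite le_eqVlt; apply/orP; left; apply/eqP.
  rewrite /phi_ratio -exprVn -prodfV -prodrXl.
  rewrite -(prod_subseq _ B) ?primes_uniq // => [|p pd].
    apply: eq_big_seq => p; rewrite mem_filter mem_primes d0 => /andP[-> _] /=.
    by case: ifP; rewrite // exprVn.
  rewrite mem_filter mem_index_iota; move: pd; rewrite mem_primes => /and3P[pp _ pd].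
  by rewrite pp prime_gt0 //= (leq_ltn_trans (dvdn_leq d0 pd)).
apply: ler_wpM2r => //.
apply: (@le_trans _ _ (\prod_(1 <= p < Y.+2) expR (24 / p%:R ^+ 2))).
  rewrite big_filter big_mkcond; apply: ler_prod => p _.
  case: ifP => _; rewrite ?ler01 ?addr_ge0 ?divr_ge0 ?exprn_ge0 //=; first exact: expR_ge1Dx.
  by rewrite -expR0 ler_expR divr_ge0 ?exprn_ge0.
rewrite -expR_sum ler_expR -mulr_sumr.
have := sum_inv_sqr_le R Y; have : 0 <= Y.+1%:R^-1 :> R by rewrite invr_ge0.
by move: (\sum_(1 <= n < _) _) Y.+1%:R^-1 => S t; lra.
Qed.

(** * Chebyshev's bounds *)

Definition primes_below (N : nat) : nat := \sum_(n < N) prime n.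

(** The square counts ordered pairs: the diagonal, and twice the pairs (m, m + d) with d > 0, where
    [m < N - d] keeps the larger member below [N]. *)
Lemma sqr_sum_bool (b : nat -> bool) N :
  ((\sum_(n < N) b n) ^ 2 =
    \sum_(n < N) b n + (\sum_(1 <= d < N) \sum_(m < N - d) (b m && b (m + d))).*2)%N.
Proof.
elim: N => [|N IH]; first by rewrite !big_ord0 big_geq.
rewrite !big_ord_recr /= sqrnD IH.
have -> : (\sum_(1 <= d < N.+1) \sum_(m < N.+1 - d) (b m && b (m + d)) =
   \sum_(1 <= d < N) \sum_(m < N - d) (b m && b (m + d)) + b N * \sum_(m < N) b m)%N.
  have E d : (1 <= d < N.+1)%N -> (\sum_(m < N.+1 - d) (b m && b (m + d)) =
      \sum_(m < N - d) (b m && b (m + d)) + (b (N - d) && b N))%N.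
    move=> /andP[d0 dN]; rewrite subSn // big_ord_recr /= subnK //.
  rewrite big_nat (eq_bigr _ (fun d h => E d h)) -big_nat big_split /=; congr (_ + _)%N.
    case: N {IH E} => [|N]; first by rewrite !big_geq.
    by rewrite big_nat_recr //= subnn big_ord0 addn0.
  rewrite big_distrr /= -(big_mkord xpredT (fun m => b N * b m)%N) big_nat_rev /=.
  rewrite big_add1 /=; apply: eq_big_nat => d /andP[_ dN].
  have -> : (N - (1 + N.+1 - d.+2) = d)%N by lia.
  by case: (b d) (b N) => -[].
move: (\sum_(1 <= d < N) _)%N (\sum_(i < N) _)%N => u v.
by rewrite -!mul2n; case: (b N) => /=; lia.
Qed.

Lemma primes_below_sqr N :
  (primes_below N ^ 2 = primes_below N + (\sum_(1 <= d < N) prime_pairs (N - d) d).*2)%N.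
Proof. exact: sqr_sum_bool. Qed.

Lemma prime_pairs_mono X Y d : (X <= Y)%N -> (prime_pairs X d <= prime_pairs Y d)%N.
Proof.
move=> XY; rewrite /prime_pairs -(subnKC XY).
by rewrite big_split_ord /= leq_addr.
Qed.

Lemma primes_below_le N : (primes_below N <= N)%N.
Proof.
rewrite /primes_below -[leqRHS](card_ord N) -sum1_card; apply: leq_sum => i _.
by case: (prime i).
Qed.

(** This is ln s <= s at the square root s of [x]. It yields N <= 4 (N / ln N) ^ 2, and later a
    polynomial bound for p_N in N. *)
Lemma sqr_ln_le (R : realType) (x : R) : 1 <= x -> ln x ^+ 2 <= 4 * x.
Proof.
move=> x1; have x0 : 0 < x by lra.
have s0 : 0 < Num.sqrt x by rewrite sqrtr_gt0.
have := ln_sublinear s0; have := sqr_sqrtr (ltW x0).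
set s := Num.sqrt x => sx ls.
have : ln x = ln s *+ 2 by rewrite -sx lnXn.
have : 0 <= ln x by rewrite ln_ge0.
move: ls; rewrite -sx => ls l0 l2; nra.
Qed.

Lemma prime_pairs_bound (R : realType) :
  exists2 B : R, 0 < B & forall X d, (0 < d)%N -> (1 < X)%N ->
    (prime_pairs X d)%:R <= B * X%:R / ln X%:R ^+ 2 * phi_ratio R d ^- 2.
Proof.
exists 2187%:R; first by rewrite ltr0n.
by move=> X d; apply: prime_pairs_le.
Qed.

(** The pair sieve already gives this: the square of the number of primes is at most N, itself O((N
    / ln N) ^ 2), plus twice the number of prime pairs, which is O((N / ln N) ^ 2) by the mean value
    of (d / phi(d)) ^ 3. *)
Lemma primes_below_upper (R : realType) :
  exists2 C : R, 0 < C & forall N, (1 < N)%N ->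
    (primes_below N)%:R <= C * (N%:R / ln N%:R).
Proof.
have [C3 C30 mom] := sum_phi_ratio_le R.
have [B B0 pairs] := prime_pairs_bound R.
have BC : 0 < B * C3 by rewrite mulr_gt0.
exists (6 + 2 * (B * C3)); first by lra.
move=> N N1; have N0 : 0 < N%:R :> R by rewrite ltr0n ltnW.
have l0 : 0 < ln N%:R :> R by rewrite ln_gt0 // ltr1n.
set q : R := N%:R / ln N%:R; have q0 : 0 < q by rewrite divr_gt0.
have Nq : N%:R <= 4 * q ^+ 2.
  rewrite /q expr_div_n mulrA ler_pdivlMr ?exprn_gt0 //.
  have := sqr_ln_le R N%:R; rewrite ler1n ltnW // => /(_ isT); nra.
have S : (\sum_(1 <= d < N) prime_pairs (N - d) d)%:R <= B * C3 * q ^+ 2 :> R.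
  rewrite natr_sum; apply: (@le_trans _ _ (\sum_(1 <= d < N.+1)
     B * N%:R / ln N%:R ^+ 2 * phi_ratio R d ^- 3)); last first.
    rewrite -mulr_sumr; apply: le_trans (ler_wpM2l _ (mom N)) _.
      by rewrite !mulr_ge0 ?invr_ge0 ?exprn_ge0 ?(ltW l0) ?(ltW B0).
    rewrite le_eqVlt; apply/orP; left; apply/eqP; rewrite /q; field.
    by rewrite gt_eqF.
  rewrite [leRHS]big_nat_recr ?(ltnW N1) //= -[leLHS]addr0; apply: lerD; last first.
    by rewrite !mulr_ge0 ?invr_ge0 ?exprn_ge0 ?(ltW l0) ?(ltW B0) ?(ltW (phi_ratio_gt0 R N)).
  rewrite big_nat [leRHS]big_nat; apply: ler_sum => d /andP[d0 dN].
  apply: (@le_trans _ _ (prime_pairs N d)%:R).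
    by rewrite ler_nat prime_pairs_mono // leq_subr.
  apply: (le_trans (pairs _ _ d0 N1)).
  apply: ler_wpM2l; first by rewrite !mulr_ge0 ?invr_ge0 ?exprn_ge0 ?(ltW l0) ?(ltW B0).
  have r0 := phi_ratio_gt0 R d; have r1 := phi_ratio_le1 R d.
  by rewrite lef_pV2 ?posrE ?exprn_gt0 // exprS ler_piMl // exprn_ge0 // ltW.
have sq : (primes_below N)%:R ^+ 2 <= N%:R + 2 * (B * C3) * q ^+ 2 :> R.
  rewrite -natrX primes_below_sqr natrD; apply: lerD.
    by rewrite ler_nat primes_below_le.
  by rewrite -muln2 natrM; lra.
set p : R := (primes_below N)%:R in sq *; have p0 : 0 <= p by rewrite ler0n.
rewrite -(ler_pXn2r (n := 2)) ?nnegrE //; last by rewrite mulr_ge0 // ?ltW //; lra.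
apply: (le_trans sq); rewrite [leRHS]exprMn.
apply: (@le_trans _ _ ((4 + 2 * (B * C3)) * q ^+ 2)); first by lra.
apply: ler_wpM2r; first exact: sqr_ge0.
clear -BC; nra.
Qed.

Lemma central_bin_ge n : (2 ^ n <= 'C(n.*2, n))%N.
Proof.
elim: n => [|n IH] //; rewrite doubleS expnS mul2n.
have h : ('C(n.*2, n) <= 'C(n.*2.+1, n.+1))%N by rewrite binS leq_addl.
have e : 'C(n.*2.+1, n) = 'C(n.*2.+1, n.+1).
  by rewrite -bin_sub; [congr 'C(_, _); lia | lia].
by rewrite binS e addnn leq_double (leq_trans IH).
Qed.

(** By Legendre's formula the exponent of [p] is the sum over k of floor(2n / p ^ k) - 2 floor(n / p
    ^ k). Each term is 0 or 1 and vanishes once p ^ k > 2n. *)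
Lemma pfactor_central_bin_le p n : prime p -> (0 < n)%N ->
  (p ^ logn p 'C(n.*2, n) <= n.*2)%N.
Proof.
move=> pp n0; have p1 := prime_gt1 pp.
apply: leq_trans (trunc_logP p1 _); last by rewrite double_gt0.
rewrite leq_pexp2l ?prime_gt0 //.
have : (logn p 'C(n.*2, n) + (logn p n`!).*2 = logn p (n.*2)`!)%N.
  rewrite -(bin_fact (m := n) (n := n.*2)); last by rewrite -addnn leq_addr.
  by rewrite !lognM ?muln_gt0 ?fact_gt0 ?bin_gt0 -?addnn ?leq_addr // addnK.
have -> : logn p n`! = (\sum_(1 <= k < n.*2.+1) n %/ p ^ k)%N.
  rewrite logn_fact // [RHS](big_cat_nat (n := n.+1)) //=; last by lia.
  rewrite [X in (_ + X)%N]big_nat [X in (_ + X)%N]big1 ?addn0 // => k /andP[nk _].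
  by rewrite divn_small // (ltn_trans nk) // ltn_expl.
rewrite logn_fact // => E.
have {E} -> : logn p 'C(n.*2, n) =
    (\sum_(1 <= k < n.*2.+1) (n.*2 %/ p ^ k - (n %/ p ^ k).*2))%N.
  apply: (@addIn (\sum_(1 <= k < n.*2.+1) n %/ p ^ k).*2); rewrite E.
  rewrite -[X in (_ + X)%N]muln2 big_distrl /= -big_split.
  apply: eq_bigr => k _ /=; rewrite muln2 subnK //.
  by rewrite leq_divRL ?expn_gt0 ?prime_gt0 // -doubleMl leq_double leq_divM.
apply: (@leq_trans (\sum_(1 <= k < n.*2.+1) (k <= trunc_log p n.*2)%N)).
  apply: leq_sum => k _; have [pk|pk] := leqP (p ^ k) n.*2.
    rewrite trunc_log_max //= leq_subLR addn1.
    rewrite -ltnS -(ltn_pmul2r (m := p ^ k)) ?expn_gt0 ?prime_gt0 //.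
    rewrite (leq_ltn_trans (leq_divM _ _)) //.
    have := ltn_ceil n (_ : 0 < p ^ k)%N; rewrite expn_gt0 prime_gt0 // => /(_ isT).
    rewrite -ltn_double => h; apply: leq_trans h _.
    by rewrite doubleMl doubleS.
  by rewrite divn_small // sub0n.
apply: leq_trans (geq_minr n.*2 _); move: (trunc_log p n.*2) => t.
elim: n.*2 => [|M IH]; first by rewrite big_geq.
by rewrite big_nat_recr //=; move: IH; case: (M.+1 <= t)%N / leqP; rewrite /minn; do ![case: ifP]; lia.
Qed.

Lemma central_bin_le n : (0 < n)%N -> ('C(n.*2, n) <= n.*2 ^ primes_below n.*2.+1)%N.
Proof.
move=> n0; have C0 : (0 < 'C(n.*2, n))%N by rewrite bin_gt0 -addnn leq_addr.
rewrite [leqLHS](prod_prime_decomp C0) prime_decompE big_map /=.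
apply: (@leq_trans (\prod_(p <- primes 'C(n.*2, n)) n.*2)%N).
  rewrite big_seq [leqRHS]big_seq; elim/big_ind2: _ => // [a b c d|p]; first exact: leq_mul.
  by rewrite mem_primes => /andP[pp _]; apply: pfactor_central_bin_le.
rewrite big_const_seq count_predT iter_muln_1 leq_pexp2l ?double_gt0 //.
apply: (@leq_trans (size [seq p <- index_iota 0 n.*2.+1 | prime p])).
  apply: uniq_leq_size; first exact: primes_uniq.
  move=> p pC; move: (pC); rewrite mem_primes mem_filter mem_index_iota => /and3P[pp _ _].
  rewrite pp /= ltnS; apply: leq_trans (pfactor_central_bin_le p n pp n0).
  by rewrite -[leqLHS]expn1; apply: leq_pexp2l; rewrite ?logn_gt0 ?prime_gt0.
by rewrite size_filter -sum1_count big_mkcond big_mkord.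
Qed.

(** Chebyshev's argument: the central binomial coefficient is at least 2 ^ n, while its prime
    factors are at most 2n and each contributes a power at most 2n. *)
Lemma primes_below_lower (R : realType) :
  exists2 c : R, 0 < c & forall N, (2 < N)%N ->
    c * (N%:R / ln N%:R) <= (primes_below N)%:R.
Proof.
have l2 : 0 < ln 2 :> R by rewrite ln_gt0 // ltr1n.
exists (ln 2 / 6); first by rewrite divr_gt0.
move=> N N3; have N0 : 0 < N%:R :> R by rewrite ltr0n; lia.
have l0 : 0 < ln N%:R :> R by rewrite ln_gt0 // ltr1n; lia.
(* The primes up to 2n are those below 2n + 1, whence 2n + 1 <= N; the 6 in the constant comes from
   N <= 6n. *)
pose n := (N.-1)./2; have n0 : (0 < n)%N by rewrite /n; lia.
have nN : (n.*2.+1 <= N)%N by rewrite /n; lia.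
have Nn : (N <= 6 * n)%N by rewrite /n; lia.
have mono : (primes_below n.*2.+1 <= primes_below N)%N.
  by rewrite /primes_below -(subnKC nN) big_split_ord /= leq_addr.
have := leq_trans (central_bin_ge n) (central_bin_le n n0).
rewrite -(ler_nat R) !natrX => h.
have {}h : ln 2 *+ n <= ln n.*2%:R *+ primes_below n.*2.+1 :> R.
  by rewrite -!lnXn ?ltr0n ?double_gt0 // ler_ln ?posrE ?exprn_gt0 ?ltr0n ?double_gt0.
rewrite mulrA ler_pdivrMr //.
apply: (@le_trans _ _ (ln 2 *+ n)).
  rewrite -[leRHS]mulr_natr -mulrA; apply: ler_wpM2l; first exact: ltW.
  by rewrite mulrC ler_pdivrMr // -natrM ler_nat mulnC.
apply: (le_trans h); rewrite -[leLHS]mulr_natl; apply: ler_pM => //.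
- by rewrite ln_ge0 // ler1n double_gt0.
- by rewrite ler_nat.
- by rewrite ler_ln ?posrE ?ltr0n ?double_gt0 // ?ler_nat; lia.
Qed.

(** The bound on [phi_ratio] keeps the measure of the neighbourhoods of reduced fractions with
    denominator [d] proportional to their radius; the other condition makes [d] comparable to the
    larger prime, at whose index [delta_min] will be evaluated. *)
Definition balanced_difference (R : realType) (k : R) (d : nat) : bool :=
  `[< k <= phi_ratio R d /\
      exists p, [/\ prime p, prime (p + d) & k * (p + d)%:R <= d%:R] >].

Lemma sum_prime_pairs_ge (R : realType) :
  exists2 c : R, 0 < c & exists N0, forall N, (N0 <= N)%N ->
    c * (N%:R / ln N%:R) ^+ 2 <= (\sum_(1 <= d < N) prime_pairs (N - d) d)%:R.
Proof.
have [c c0 low] := primes_below_lower R.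
exists (c ^+ 2 / 4); first by rewrite divr_gt0 ?exprn_gt0.
(* With at least two primes below N, the diagonal takes at most half of the square, so the pairs
   number at least a quarter of it. *)
exists 6%N => N N6.
have p2 : (2 <= primes_below N)%N.
  rewrite /primes_below -(subnKC N6) big_split_ord /= !big_ord_recl /=.
  by rewrite /bump /=; lia.
have := primes_below_sqr N; set S := (\sum_(1 <= d < N) _)%N => E.
have l0 : 0 < ln N%:R :> R by rewrite ln_gt0 // ltr1n; lia.
have h := low N (leq_trans (isT : 3 <= 6)%N N6).
have {h} : (c * (N%:R / ln N%:R)) ^+ 2 <= (primes_below N)%:R ^+ 2.
  rewrite ler_sqr ?nnegrE // mulr_ge0 ?divr_ge0 // ltW //.
have : ((primes_below N) ^ 2 <= 4 * S)%N by nia.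
rewrite -(ler_nat R) natrX natrM exprMn; set q := (N%:R / _) ^+ 2.
move=> h1 h2; rewrite mulrAC ler_pdivrMr // mulrC; lra.
Qed.

(** Measured by the sieve bound, the d with phi(d) / d < k contribute at most k times the third
    moment, and the d <= k N at most the third moment up to k N. Any other d with a prime pair is
    balanced, since p + d < N gives k (p + d) <= k N < d, and its sieve factor is at most k ^- 2. *)
Lemma prime_difference_density (R : realType) :
  exists k c : R, [/\ 0 < k, 0 < c & exists N0, forall N, (N0 <= N)%N ->
    c * N%:R <= \sum_(1 <= d < N) (balanced_difference R k d)%:R].
Proof.
have [C C0 mom] := sum_phi_ratio_le R.
have [B B0 pairs] := prime_pairs_bound R.
have [c c0 [N0 low]] := sum_prime_pairs_ge R.
have BC : 0 < B * C by rewrite mulr_gt0.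
(* Up to the common factor, the two losses add up to 2 B C k, which this choice makes half of the
   lower bound [c] for the pairs. *)
have [k k0 kE] : exists2 k : R, 0 < k & k * (4 * (B * C)) = c.
  exists (c / (4 * (B * C))); first by rewrite divr_gt0 // mulr_gt0.
  by rewrite mulfVK // gt_eqF // mulr_gt0.
exists k, (c / 2 * k ^+ 2 / B); split => //.
  by rewrite divr_gt0 // mulr_gt0 ?exprn_gt0 // divr_gt0.
exists (maxn N0 2) => N; rewrite geq_max => /andP[NN0 N2].
have l0 : 0 < ln N%:R :> R by rewrite ln_gt0 // ltr1n.
have N0' : 0 < N%:R :> R by rewrite ltr0n; lia.
set A : R := N%:R / ln N%:R ^+ 2; have A0 : 0 < A by rewrite divr_gt0 ?exprn_gt0.
have pr d := phi_ratio_gt0 R d.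
pose G d : R := (balanced_difference R k d)%:R.
pose t d := phi_ratio R d ^- 3.
have t0 d : 0 < t d by rewrite invr_gt0 exprn_gt0.
have pw d : (0 < d)%N -> (d < N)%N -> (prime_pairs (N - d) d)%:R <=
    B * A * (k ^- 2 * G d + k * t d + (d <= Num.truncn (k * N%:R))%N%:R * t d).
  move=> d0 dN.
  have [->|pp0] := eqVneq (prime_pairs (N - d) d) 0%N.
    apply: mulr_ge0; first by rewrite mulr_ge0 ?ltW.
    by rewrite !addr_ge0 ?mulr_ge0 ?invr_ge0 ?exprn_ge0 // ?(ltW k0) // ltW.
  apply: (@le_trans _ _ (B * A * phi_ratio R d ^- 2)).
    rewrite mulrA; apply: le_trans (pairs N d d0 N2).
    by rewrite ler_nat prime_pairs_mono // leq_subr.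
  apply: ler_wpM2l; first by rewrite mulr_ge0 ?ltW.
  have tr : phi_ratio R d ^- 2 = phi_ratio R d * t d.
    by rewrite /t; field; rewrite gt_eqF.
  have [kp|pk] := leP k (phi_ratio R d); last first.
    rewrite tr; apply: (@le_trans _ _ (k * t d)); first by rewrite ler_pM2r // ltW.
    rewrite addrAC lerDr addr_ge0 ?mulr_ge0 ?invr_ge0 ?exprn_ge0 // ltW //.
  have [dk|kd] := leqP d (Num.truncn (k * N%:R)).
    rewrite mul1r; apply: (@le_trans _ _ (t d)).
      by rewrite tr -[leRHS]mul1r ler_pM2r // phi_ratio_le1.
    by rewrite lerDr addr_ge0 ?mulr_ge0 ?invr_ge0 ?exprn_ge0 // ltW.
  have -> : G d = 1.
    rewrite /G /balanced_difference asboolT //; split => //.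
    move: pp0; rewrite /prime_pairs sum_nat_eq0 negb_forall => /existsP[p] /=.
    rewrite eqb0 negbK => /andP[p1 p2].
    exists p; split=> //; apply: (@le_trans _ _ (k * N%:R)).
      rewrite ler_pM2l // ler_nat; by have := ltn_ord p; rewrite ltn_subRL addnC => /ltnW.
    by apply: ltW; rewrite -truncn_lt_nat // mulr_ge0 // ltW.
  rewrite mul0r addr0 mulr1; apply: (@le_trans _ _ (k ^- 2)).
    by rewrite lef_pV2 ?posrE ?exprn_gt0 // ler_sqr ?nnegrE ?(ltW k0) ?(ltW (pr d)).
  by rewrite lerDl mulr_ge0 ?ltW.
have sumt Y : \sum_(1 <= d < Y.+1) t d <= C * Y%:R := mom Y.
have S1 : \sum_(1 <= d < N) t d <= C * N%:R.
  apply: le_trans (sumt N); rewrite [leRHS]big_nat_recr //=; last by lia.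
  by rewrite lerDl ltW.
have S2 : \sum_(1 <= d < N) (d <= Num.truncn (k * N%:R))%N%:R * t d <= C * (k * N%:R).
  have kN0 : 0 <= k * N%:R by rewrite mulr_ge0 ?ltW.
  set Y := Num.truncn (k * N%:R).
  apply: (@le_trans _ _ (\sum_(1 <= d < Y.+1) t d)); last first.
    by apply: (le_trans (sumt Y)); rewrite ler_pM2l // truncn_le.
  rewrite (eq_bigr (fun d => if (d <= Y)%N then t d else 0)); last first.
    by move=> d _; case: (d <= Y)%N; rewrite ?mul1r ?mul0r.
  rewrite -big_mkcond; have [YN|NY] := leqP Y.+1 N.
    by rewrite [leRHS](big_nat_widen _ _ N) //.
  apply: (@le_trans _ _ (\sum_(1 <= d < N) t d)).
    by rewrite big_mkcond; apply: ler_sum => d _; case: ifP => // _; rewrite ltW.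
  rewrite [leRHS](big_cat_nat (n := N)) ?(ltnW NY) 1?ltnW //= lerDl.
  by apply: sumr_ge0 => d _; rewrite ltW.
have := low N NN0; rewrite natr_sum => h.
have {h} : c * (N%:R / ln N%:R) ^+ 2 <= B * A * (k ^- 2 * \sum_(1 <= d < N) G d +
    k * (C * N%:R) + C * (k * N%:R)).
  apply: (le_trans h); apply: (@le_trans _ _ (\sum_(1 <= d < N) B * A *
      (k ^- 2 * G d + k * t d + (d <= Num.truncn (k * N%:R))%N%:R * t d))).
    by rewrite big_nat [leRHS]big_nat; apply: ler_sum => d /andP[]; apply: pw.
  rewrite -mulr_sumr !big_split /= -!mulr_sumr; apply: ler_wpM2l.
    by rewrite mulr_ge0 ?ltW.
  by apply: lerD => //; apply: lerD => //; rewrite ler_pM2l.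
rewrite -/G; set S := \sum_(1 <= d < N) G d.
have -> : c * (N%:R / ln N%:R) ^+ 2 = A * (c * N%:R).
  by rewrite /A; field; rewrite gt_eqF.
rewrite [B * A]mulrC -[leRHS]mulrA ler_pM2l // -kE => h.
have -> : k * (4 * (B * C)) / 2 * k ^+ 2 / B * N%:R = 2 * C * k * N%:R * k ^+ 2.
  by field; rewrite gt_eqF.
rewrite -ler_pdivlMr ?exprn_gt0 //.
rewrite -(ler_pM2l B0).
have : B * (k ^- 2 * S + k * (C * N%:R) + C * (k * N%:R)) =
   B * (S / k ^+ 2) + B * (2 * C * k * N%:R) by ring.
move: h; lra.
Qed.

(** * Limsup sets of neighbourhoods of fractions *)

(** Stated for arbitrary sets, because [lebesgue_measure] is evaluated as an outer measure on every
    set; the limsup sets below are compared in this way. *)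
Lemma le_lebesgue (R : realType) (A B : set R) : A `<=` B ->
  (@lebesgue_measure R A <= @lebesgue_measure R B)%E.
Proof. exact: (@le_outer_measure _ _ (mu_ext (@wlength R idfun))). Qed.

Lemma lebesgueU2 (R : realType) (A B : set R) :
  (@lebesgue_measure R (A `|` B) <= @lebesgue_measure R A + @lebesgue_measure R B)%E.
Proof. exact: (@outer_measureU2 _ _ (mu_ext (@wlength R idfun))). Qed.

Lemma lebesgue_bigU_le (R : realType) (I : Type) (s : seq I) (P : pred I) (F : I -> set R) :
  (@lebesgue_measure R (\big[setU/set0]_(i <- s | P i) F i) <=
   \sum_(i <- s | P i) @lebesgue_measure R (F i))%E.
Proof.
elim/big_rec2: _ => [|i x A _ IH]; first by rewrite measure0.
by apply: le_trans (lebesgueU2 _ _ _) _; rewrite leeD2l.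
Qed.

Lemma lebesgue_affine (R : realType) (a b : R) (X : set R) : 0 < a ->
  measurable (X : set (measurableTypeR R)) ->
  (@lebesgue_measure R X = a%:E * @lebesgue_measure R ((fun x => (a * x + b)%R) @^-1` X))%E.
Proof.
move=> a0 mX.
pose f (x : measurableTypeR R) : measurableTypeR R := a * x + b.
have mf : measurable_fun setT f.
  apply: (@continuous_measurable_fun R) => x.
  by apply: cvgD; [apply: cvgMl_tmp; exact: cvg_id | exact: cvg_cst].
pose nu := mscale (NngNum (ltW a0)) (pushforward (@lebesgue_measure R) f).
apply: (@lebesgue_measure_unique R (nu mf)) => //.
move=> _ [[u v] _ <-].
have E : f @^-1` `]u, v]%classic = `](u - b) / a, (v - b) / a]%classic.
  apply/seteqP; split => x /=; rewrite !in_itv /= ltr_pdivrMr // ler_pdivlMr //;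
  by rewrite ltrBlDr lerBrDr mulrC.
change (@lebesgue_measure R `]u, v] = a%:E * @lebesgue_measure R (f @^-1` `]u, v]))%E.
rewrite E !lebesgue_measure_itv /= !lte_fin ltr_pM2r ?invr_gt0 // ltrD2r.
case: ifP => _; last by rewrite mule0.
by rewrite -!EFinB -EFinM; congr (_%:E); field; rewrite gt_eqF.
Qed.

(* If B(x, r) is nearly filled by V, multiplying it by some n > 1 / r and translating covers [0, 1]. *)
Lemma zero_one_law (R : realType) (V W : set R) :
  measurable (V : set (measurableTypeR R)) -> V `<=` W -> (0 < @lebesgue_measure R V)%E ->
  (forall x (n : nat), (0 < n)%N -> W x -> W (n%:R * x)) ->
  (forall x (m : int), W x -> W (x + m%:~R)) ->
  @lebesgue_measure R (`[0, 1]%classic `\` W) = 0%E.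
Proof.
move=> mV VW V0 Wmul Wadd.
apply/eqP; rewrite eq_le measure_ge0 andbT; apply/lee_addgt0Pr => e e0; rewrite add0e.
have [x [Vx dens]] : exists x, V x /\
    ((lebesgue_measure (V `&` ball x r) * (lebesgue_measure (ball x r))^-1)%E
       @[r --> (0:R)^'+] --> (\1_V x)%:E).
  apply: contrapT => /forallNP nV.
  have [N [mN N0 NV]] := lebesgue_density mV.
  have : (@lebesgue_measure R V <= lebesgue_measure N)%E.
    apply: le_lebesgue => x Vx; apply: NV => /= dens.
    by apply: (nV x).
  by rewrite N0 leNgt V0.
have [r /andP[r0 r1] hr] : exists2 r : R, 0 < r < 1 &
    ((1 - e / 4)%:E < @lebesgue_measure R (V `&` ball x r) / lebesgue_measure (ball x r))%E.
  rewrite indicE mem_set // in dens.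
  have lt1 : ((1 - e / 4)%:E < (true%:R : R)%:E)%E by rewrite lte_fin /=; lra.
  have near_dens : \forall r \near (0:R)^'+,
    ((1 - e / 4)%:E < @lebesgue_measure R (V `&` ball x r) / lebesgue_measure (ball x r))%E.
    exact: dens _ (open_ereal_gt' lt1).
  have [r [[r0 r1] hr]] :=
    filter_ex (filterI (filterI (nbhs_right_gt (0 : R)) (nbhs_right_lt ltr01)) near_dens).
  by exists r; rewrite ?r0.
(* From 1 < n r, the points (y + m) / n with y in [0, 1] all lie in the ball. From n r <= 2, the
   defect of the ball, at most 2 r (e / 4), has measure at most e after dilation by [n]. *)
pose n := (Num.truncn r^-1).+1; pose m := Num.floor (n%:R * x).
have rn : 1 < n%:R * r.
  have := truncn_itv (_ : 0 <= r^-1); rewrite invr_ge0 ltW // => /(_ isT) /andP[_ h].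
  by rewrite -(ltr_pM2r r0) mulVf ?gt_eqF // in h.
have nr : n%:R * r <= 2.
  have := truncn_itv (_ : 0 <= r^-1); rewrite invr_ge0 ltW // => /(_ isT) /andP[h _].
  rewrite /n -natr1 mulrDl mul1r.
  have : (Num.truncn r^-1)%:R * r <= 1 by rewrite -ler_pdivlMr // div1r.
  lra.
have n0 : 0 < n%:R :> R by rewrite ltr0n.
have n0' : n%:R != 0 :> R by rewrite gt_eqF.
pose B := ball x r `\` V.
have mB : measurable (B : set (measurableTypeR R)).
  by apply: measurableD => //; exact: measurable_ball.
have incl : `[0, 1]%classic `\` W `<=` (fun y => n%:R^-1 * y + m%:~R / n%:R) @^-1` B.
  move=> y [/=]; rewrite in_itv /= => /andP[y0 y1] nWy; split.
    rewrite /ball /= /ball_ /=.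
    have -> : x - (n%:R^-1 * y + m%:~R / n%:R) = ((n%:R * x - m%:~R) - y) / n%:R by field.
    rewrite normrM normfV (gtr0_norm n0) ltr_pdivrMr // (mulrC r).
    have := floor_itv (n%:R * x); rewrite -/m intrD => /andP[m1 m2].
    by apply: le_lt_trans rn; rewrite ler_norml; apply/andP; split; lra.
  move=> /VW h; apply: nWy.
  have := Wadd _ (- m) (Wmul _ n isT h); rewrite intrN.
  by have -> : n%:R * (n%:R^-1 * y + m%:~R / n%:R) - m%:~R = y by field.
apply: (le_trans (le_lebesgue _ _ _ incl)).
have bB : lebesgue_measure (ball x r) = (r *+ 2)%:E by rewrite lebesgue_measure_ball ?ltW.
have small : (lebesgue_measure B <= (r *+ 2 * (e / 4))%:E)%E.
  have hE : (@lebesgue_measure R (ball x r) =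
      lebesgue_measure B + lebesgue_measure (V `&` ball x r))%E.
    by rewrite [V `&` _]setIC; apply: measureDI => //; exact: measurable_ball.
  move: hr hE; rewrite bB.
  have : (lebesgue_measure (V `&` ball x r) <= (r *+ 2)%:E)%E.
    by rewrite -bB; apply: le_lebesgue; exact: subIsetr.
  have : (0 <= lebesgue_measure (V `&` ball x r))%E by apply: measure_ge0.
  move: (lebesgue_measure (V `&` ball x r)) => [p| |] //= _ _.
  have r2 : r *+ 2 != 0 by rewrite mulrn_eq0 /= gt_eqF.
  rewrite inver (negbTE r2) -EFinM lte_fin ltr_pdivlMr; last by lra.
  have : (0 <= lebesgue_measure B)%E by apply: measure_ge0.
  move: (lebesgue_measure B) => [q| |] // _ hp.
  by rewrite -EFinD lee_fin => -[]; lra.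
apply: (@le_trans _ _ (n%:R%:E * lebesgue_measure B)%E).
  have := lebesgue_affine R n%:R^-1 (m%:~R / n%:R) B _ mB; rewrite invr_gt0 => /(_ n0) ->.
  by rewrite muleA -EFinM divff // mul1e.
apply: (@le_trans _ _ (n%:R%:E * (r *+ 2 * (e / 4))%:E)%E).
  by rewrite lee_pmul2l // lte_fin.
rewrite -EFinM lee_fin.
have -> : n%:R * (r *+ 2 * (e / 4)) = (n%:R * r) * (e / 2) by field.
have := ler_wpM2r (ltW (divr_gt0 e0 (ltr0n R 2))) nr.
lra.
Qed.

(** * Quasi-independence of neighbourhoods of reduced fractions *)

Lemma bonferroni d (T : measurableType d) (R : realType) (mu : {measure set T -> \bar R})
    (F : nat -> set T) n : (forall i, measurable (F i)) ->
  (\sum_(i < n) mu (F i) <= mu (\big[setU/set0]_(i < n) F i) +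
     \sum_(i < n) \sum_(j < i) mu (F j `&` F i))%E.
Proof.
move=> mF; elim: n => [|n IH]; first by rewrite !big_ord0 measure0 adde0.
rewrite !big_ord_recr /=; set U := \big[setU/set0]_(i < n) F i in IH *.
set S := (\sum_(i < n) _)%E in IH *.
set Q := (\sum_(i < n) \sum_(j < i) _)%E in IH *.
have mU : measurable U by apply: bigsetU_measurable.
have E : (mu (U `|` F n) + mu (U `&` F n) = mu U + mu (F n))%E.
  have -> : U `|` F n = U `|` (F n `\` U) by rewrite setDE setUIr setUCr setIT.
  rewrite measureU //; first last.
  - by rewrite setDE setICA setICr setI0.
  - exact: measurableD.
  - by rewrite -addeA; congr (_ + _)%E; rewrite setIC -measureDI.
have UF : (mu (U `&` F n) <= \sum_(j < n) mu (F j `&` F n))%E.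
  rewrite /U big_distrl /=.
  have := @Boole_inequality _ _ _ mu (fun j => F j `&` F n) n.
  by apply => i _; apply: measurableI.
apply: (@le_trans _ _ (mu U + Q + mu (F n))%E); first exact: leeD2r.
by rewrite addeAC -E -[leLHS]addeA; apply: leeD2l; rewrite addeC; apply: leeD2l.
Qed.

Lemma eq_of_linear_forms q r a b a' b' : (0 < q)%N -> coprime q r ->
  (a * r + b' * q = a' * r + b * q)%N -> (a %/ q = a' %/ q)%N -> a = a'.
Proof.
move=> q0 cop; wlog aa' : a b a' b' / (a <= a')%N => [wl e ea|e ea].
  have [h|/ltnW h] := leqP a a'; first exact: wl h e ea.
  by apply: esym; apply: wl h (esym e) (esym ea).
have : (q %| (a' - a) * r)%N.
  apply/dvdnP; exists (b' - b)%N; rewrite !mulnBl.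
  by have := leq_mul aa' (leqnn r); lia.
rewrite Gauss_dvdl // => /dvdnP[k ka].
have a'E : a' = (k * q + a)%N by lia.
have : k = 0%N by move: ea; rewrite a'E divnMDl //; lia.
by move=> k0; rewrite a'E k0.
Qed.

(* Writing q = q' g and r = r' g with g = gcd(q, r), the pair (a, b) is determined by the multiple
   a r - b q of g and by a %/ q', the latter taking g values. *)
Lemma card_linear_forms_pos q r K : (0 < q)%N -> (0 < r)%N ->
  (#|[set ab : 'I_q * 'I_r | (ab.2 * q < ab.1 * r)%N && (ab.1 * r <= ab.2 * q + K)%N]%SET| <= K)%N.
Proof.
move=> q0 r0.
set S := [set ab | _]%SET; pose g := gcdn q r.
have g0 : (0 < g)%N by rewrite gcdn_gt0 q0.
have [q' qE] : exists q', q = (q' * g)%N by apply/dvdnP; exact: dvdn_gcdl.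
have [r' rE] : exists r', r = (r' * g)%N by apply/dvdnP; exact: dvdn_gcdr.
have q'0 : (0 < q')%N by move: q0; rewrite qE muln_gt0 => /andP[].
have cop : coprime q' r'.
  have : (gcdn (q' * g) (r' * g) = 1 * g)%N by rewrite -qE -rE mul1n.
  by rewrite -muln_gcdl => /eqP; rewrite eqn_pmul2r // => /eqP h; apply/eqP.
case: K @S => [|K] S.
  by rewrite leqn0 cards_eq0; apply/eqP/setP => -[a b]; rewrite !inE /=; lia.
(* The difference is a positive multiple of [g]. Lowering the multiplier by one keeps the code k g +
   a %/ q' strictly below the bound on the difference, because a %/ q' < g. *)
pose k (ab : 'I_q * 'I_r) : nat := (ab.1 * r' - ab.2 * q').-1.
pose f (ab : 'I_q * 'I_r) : 'I_K.+1 := inord (k ab * g + ab.1 %/ q').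
have agt (ab : 'I_q * 'I_r) : (ab.1 %/ q' < g)%N.
  by rewrite ltn_divLR // mulnC -qE.
have kP ab : ab \in S -> (ab.2 * q' < ab.1 * r')%N /\ (k ab * g + ab.1 %/ q' < K.+1)%N.
  rewrite inE.
  have -> : (ab.2 * q = ab.2 * q' * g)%N by rewrite -mulnA -qE.
  have -> : (ab.1 * r = ab.1 * r' * g)%N by rewrite -mulnA -rE.
  rewrite ltn_pmul2r // => /andP[h1 h2]; split => //.
  have h3 : ((k ab).+1 * g <= K.+1)%N.
    by rewrite /k prednK ?subn_gt0 // mulnBl leq_subLR.
  apply: leq_trans h3; rewrite mulSn addnC ltn_add2r; exact: agt.
have finj : {in S &, injective f}.
  move=> [a b] [a' b'] abS abS' /(congr1 val).
  have [h1 h2] := kP _ abS; have [h1' h2'] := kP _ abS'.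
  rewrite /f /= !inordK // => e.
  have ek : k (a, b) = k (a', b').
    have := congr1 (fun x => x %/ g)%N e.
    by rewrite !divnMDl // (divn_small (agt (a, b))) (divn_small (agt (a', b'))) !addn0.
  have ea : (a %/ q' = a' %/ q')%N by move: e; rewrite ek => /addnI.
  have ekk : (a * r' + b' * q' = a' * r' + b * q')%N.
    move: ek h1 h1'; rewrite /k /=; lia.
  have eaa : a = a'.
    by apply/val_inj; apply: (eq_of_linear_forms q' r' a b a' b').
  rewrite eaa; congr (_, _); apply/val_inj/eqP => /=.
  by move: ekk; rewrite eaa => /addnI/eqP; rewrite eqn_pmul2r // eq_sym.
by rewrite -(card_in_imset finj) -[leqRHS]card_ord max_card.
Qed.

Lemma card_linear_forms q r K : (0 < q)%N -> (0 < r)%N ->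
  (#|[set ab : 'I_q * 'I_r | [&& (ab.1 * r != ab.2 * q)%N,
      (ab.1 * r <= ab.2 * q + K)%N & (ab.2 * q <= ab.1 * r + K)%N]]%SET| <= K.*2)%N.
Proof.
move=> q0 r0; rewrite -addnn.
have sub : [set ab : 'I_q * 'I_r | [&& (ab.1 * r != ab.2 * q)%N,
      (ab.1 * r <= ab.2 * q + K)%N & (ab.2 * q <= ab.1 * r + K)%N]]%SET \subset
   [set ab : 'I_q * 'I_r | (ab.2 * q < ab.1 * r)%N && (ab.1 * r <= ab.2 * q + K)%N]%SET :|:
   [set ab : 'I_q * 'I_r | (ab.1 * r < ab.2 * q)%N && (ab.2 * q <= ab.1 * r + K)%N]%SET.
  by apply/fintype.subsetP => ab; rewrite !inE; lia.
apply: leq_trans (subset_leq_card sub) _; apply: leq_trans (leq_card_setU _ _) _.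
apply: leq_add; first exact: card_linear_forms_pos.
pose sw (ab : 'I_q * 'I_r) := (ab.2, ab.1).
have swi : injective sw by move=> [a b] [a' b'] [-> ->].
rewrite -(card_imset _ swi); apply: leq_trans (card_linear_forms_pos r q K r0 q0).
apply: subset_leq_card; apply/fintype.subsetP => _ /imsetP[ab abS ->].
by move: abS; rewrite !inE.
Qed.

Definition near_fraction (R : realType) (e : R) (q a : nat) : set R :=
  `[(a%:R - e) / q%:R, (a%:R + e) / q%:R]%classic.

Definition near_reduced (R : realType) (e : R) (q : nat) : set R :=
  \big[setU/set0]_(a < q | coprime a q) near_fraction R e q a.

Lemma near_fractionP (R : realType) (e : R) q a x : (0 < q)%N ->
  near_fraction R e q a x <-> `|q%:R * x - a%:R| <= e.
Proof.
move=> q0; have q0' : 0 < q%:R :> R by rewrite ltr0n.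
rewrite /near_fraction /= in_itv /= ler_pdivrMr // ler_pdivlMr // ler_norml.
by split => /andP[h1 h2]; apply/andP; split; lra.
Qed.

Lemma near_reducedP (R : realType) (e : R) q x :
  near_reduced R e q x <-> exists2 a, (a < q)%N && coprime a q & near_fraction R e q a x.
Proof.
split; last first.
  case=> a /andP[aq c] h; rewrite /near_reduced (bigD1 (Ordinal aq)) //=.
  by left.
rewrite /near_reduced; elim/big_rec: _ => [[]|a A c IH [h|/IH //]].
by exists a => //; rewrite ltn_ord.
Qed.

Lemma measurable_near_reduced (R : realType) (e : R) q :
  measurable (near_reduced R e q : set (measurableTypeR R)).
Proof. by apply: bigsetU_measurable => a _; exact: measurable_itv. Qed.

Lemma lebesgue_near_fraction (R : realType) (e : R) q a : (0 < q)%N -> 0 <= e ->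
  @lebesgue_measure R (near_fraction R e q a) = (2 * e / q%:R)%:E.
Proof.
move=> q0 e0; have q0' : 0 < q%:R :> R by rewrite ltr0n.
rewrite /near_fraction lebesgue_measure_itv /= lte_fin ltr_pM2r ?invr_gt0 //.
case: ltP => h; first by rewrite -EFinB; congr (_%:E); field; rewrite gt_eqF.
have -> : e = 0 by lra.
by rewrite mulr0 mul0r.
Qed.

Lemma phi_ratio_totient (R : realFieldType) q : (0 < q)%N ->
  (totient q)%:R = q%:R * phi_ratio R q.
Proof.
move=> q0; rewrite totientE // natr_prod /phi_ratio.
rewrite {1}[q in RHS](prod_prime_decomp q0) prime_decompE big_map /= natr_prod -big_split /=.
apply: eq_big_seq => p pq; have [pp lp] : prime p /\ (0 < logn p q)%N.
  by rewrite logn_gt0; split => //; move: pq; rewrite mem_primes => /andP[].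
have p0 : p%:R != 0 :> R by rewrite pnatr_eq0 -lt0n prime_gt0.
rewrite -{2}(prednK lp) expnS !natrM -subn1 natrB ?prime_gt0 //; field.
exact: p0.
Qed.

Lemma lebesgue_near_reduced (R : realType) (e : R) q : (0 < q)%N -> 0 <= e -> e < 2^-1 ->
  @lebesgue_measure R (near_reduced R e q) = (2 * e * phi_ratio R q)%:E.
Proof.
move=> q0 e0 e1; rewrite /near_reduced measure_bigsetU_ord_cond; first last.
- move=> a b _ _ [x [/near_fractionP -/(_ q0)]].
  rewrite ler_norml => /andP[a1 a2] /near_fractionP -/(_ q0).
  rewrite ler_norml => /andP[b1 b2]; apply/val_inj => /=.
  have : a%:R < b%:R + 1 :> R by lra.
  have : b%:R < a%:R + 1 :> R by lra.
  by rewrite !natr1 !ltr_nat; lia.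
- by move=> a _; exact: measurable_itv.
rewrite (eq_bigr (fun=> (2 * e / q%:R)%:E)); last first.
  by move=> a _; exact: lebesgue_near_fraction.
rewrite sumEFin; congr (_%:E).
have -> : \sum_(a < q | coprime a q) (2 * e / q%:R) = 2 * e / q%:R * (totient q)%:R.
  rewrite totient_count_coprime big_mkord natr_sum mulr_sumr big_mkcond.
  by apply: eq_bigr => a _; rewrite coprime_sym; case: coprime; rewrite ?mulr1 ?mulr0.
by rewrite phi_ratio_totient //; field; rewrite pnatr_eq0 -lt0n.
Qed.

(** Intervals around a / q and b / r meet only if |a r - b q| <= D = e r + f q, and a r differs from
    b q because reduced fractions with distinct denominators differ. So at most 2 D pairs meet, with
    no additive error. For e r <= f q one has D <= 2 f q, and each overlap has length at most 2 e /
    q. *)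
Lemma lebesgue_near_reducedI (R : realType) (e f : R) q r :
  (0 < q)%N -> (0 < r)%N -> q != r -> 0 <= e -> 0 <= f ->
  (@lebesgue_measure R (near_reduced R e q `&` near_reduced R f r) <= (8 * e * f)%:E)%E.
Proof.
wlog efqr : e f q r / e * r%:R <= f * q%:R => [wl|].
  move=> q0 r0 qr e0 f0; have [h|/ltW h] := leP (e * r%:R) (f * q%:R).
    exact: wl.
  by rewrite setIC mulrAC; apply: wl => //; rewrite eq_sym.
move=> q0 r0 qr e0 f0.
have q0' : 0 < q%:R :> R by rewrite ltr0n.
pose D : R := e * r%:R + f * q%:R; pose K := Num.truncn D.
have D0 : 0 <= D by rewrite addr_ge0 ?mulr_ge0.
have DK : D < K.+1%:R by have /andP[] := truncn_itv D0.
pose S := [set ab : 'I_q * 'I_r | [&& (ab.1 * r != ab.2 * q)%N,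
      (ab.1 * r <= ab.2 * q + K)%N & (ab.2 * q <= ab.1 * r + K)%N]]%SET.
pose w : R := 2 * e / q%:R; have w0 : 0 <= w by rewrite divr_ge0 ?mulr_ge0.
apply: (@le_trans _ _ (\sum_(a < q) \sum_(b < r) (if (a, b) \in S then w else 0)%:E)%E).
  rewrite /near_reduced big_distrl /=; apply: (le_trans (lebesgue_bigU_le _ _ _ _ _)).
  rewrite big_mkcond; apply: lee_sum => a _.
  case: ifP => ca; last by apply: sume_ge0 => b _; rewrite lee_fin; case: ifP.
  rewrite big_distrr /=; apply: (le_trans (lebesgue_bigU_le _ _ _ _ _)).
  rewrite big_mkcond; apply: lee_sum => b _.
  case: ifP => cb; last by rewrite lee_fin; case: ifP.
  case: ifPn => [_|abS].
    rewrite /w -(lebesgue_near_fraction R e q a) //; apply: le_lebesgue; exact: subIsetl.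
  rewrite (_ : _ `&` _ = set0) ?measure0 //.
  apply/seteqP; split => // x [/near_fractionP -/(_ q0) h1 /near_fractionP -/(_ r0) h2].
  move/negP: abS; apply; rewrite inE /=; apply/and3P; split.
  - apply/eqP => E; move/eqP: qr; apply; apply/eqP; rewrite eqn_dvd; apply/andP; split.
      have : (q %| a * r)%N by rewrite E dvdn_mull.
      by rewrite Gauss_dvdr // coprime_sym.
    have : (r %| b * q)%N by rewrite -E dvdn_mull.
    by rewrite Gauss_dvdr // coprime_sym.
  - rewrite -ltnS -addnS -(ltr_nat R) natrD !natrM.
    have := DK; rewrite /D; move: h1 h2; rewrite !ler_norml => /andP[h1 _] /andP[_ h2].
    have r1 := ler_wpM2r (ler0n R r) h1; have q1 := ler_wpM2r (ler0n R q) h2.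
    lra.
  - rewrite -ltnS -addnS -(ltr_nat R) natrD !natrM.
    have := DK; rewrite /D; move: h1 h2; rewrite !ler_norml => /andP[_ h1] /andP[h2 _].
    have r1 := ler_wpM2r (ler0n R r) h1; have q1 := ler_wpM2r (ler0n R q) h2.
    lra.
apply: (@le_trans _ _ (K.*2%:R * w)%:E).
  under eq_bigr do rewrite sumEFin.
  rewrite sumEFin lee_fin pair_big /= -big_mkcond /=.
  rewrite (eq_bigl (fun ab => ab \in S)); last by case.
  rewrite sumr_const -[leLHS]mulr_natl; apply: ler_wpM2r => //.
  by rewrite ler_nat card_linear_forms.
rewrite lee_fin -muln2 natrM.
have KD : K%:R <= D by rewrite truncn_le.
have : K%:R * w <= (2 * (f * q%:R)) * w.
  by apply: ler_wpM2r => //; apply: (le_trans KD); rewrite /D; lra.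
have -> : 2 * (f * q%:R) * w = 4 * e * f by rewrite /w; field; rewrite gt_eqF.
lra.
Qed.

(** * Positive measure of the limsup set, and full measure along a dense set *)

Lemma sum_lower_pairs_le (R : realFieldType) (u : nat -> R) n :
  (\sum_(i < n) \sum_(j < i) u j * u i) *+ 2 <= (\sum_(i < n) u i) ^+ 2.
Proof.
elim: n => [|n IH]; first by rewrite !big_ord0 mul0rn expr0n.
rewrite !big_ord_recr /= -mulr_suml.
move: IH; set S := \sum_(i < n) u i; set Q := \sum_(i < n) _ => IH.
have := sqr_ge0 (u n); rewrite sqrrD mulrnDl; lra.
Qed.

(** The block stops as soon as its sum reaches [e], and its last term adds at most [e]. *)
Lemma sum_block (R : realFieldType) (u : nat -> R) (e : R) M :
  (forall q, 0 <= u q) -> (forall q, (M <= q)%N -> u q <= e) ->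
  (forall B, exists N, B <= \sum_(0 <= q < N) u q) ->
  exists n, e <= \sum_(i < n) u (M + i)%N <= 2 * e.
Proof.
move=> u0 ue unb.
have ex : exists n, e <= \sum_(i < n) u (M + i)%N.
  have [N hN] := unb (e + \sum_(0 <= q < M) u q); exists N.
  rewrite -(lerD2r (\sum_(0 <= q < M) u q)) addrC [leRHS]addrC addrC.
  apply: (le_trans hN); rewrite !big_mkord -sum_ord_add addnC sum_ord_add lerDl.
  exact: sumr_ge0.
case: (ex_minnP ex) => n hn nmin; exists n; rewrite hn /=.
case: n hn nmin => [|n] hn nmin.
  by rewrite big_ord0 mulr_ge0 // (le_trans (u0 M)) ?ue.
rewrite big_ord_recr /=; have un := ue (M + n)%N (leq_addr _ _).
have : \sum_(i < n) u (M + i)%N < e.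
  by rewrite ltNge; apply/negP => /nmin; rewrite ltnn.
lra.
Qed.

(** Each tail contains a block to which Bonferroni's inequality gives measure at least e k. The
    bound does not depend on the tail, so it passes to the limsup by continuity from above. *)
Lemma limsup_positive (R : realType) (D : pred nat) (k : R) (psi : nat -> R) :
  0 < k -> (forall q, D q -> (0 < q)%N) -> (forall q, D q -> k <= phi_ratio R q) ->
  (forall q, 0 <= psi q) ->
  (forall e, 0 < e -> exists M, forall q, (M <= q)%N -> psi q < e) ->
  (forall B, exists N, B <= \sum_(0 <= q < N | D q) psi q) ->
  exists V : set R, [/\ measurable (V : set (measurableTypeR R)),
    (0 < @lebesgue_measure R V)%E &
    forall x, V x -> forall M, exists q, [/\ (M <= q)%N, D q &
       exists a : nat, `|q%:R * x - a%:R| <= psi q]].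
Proof.
move=> k0 D0 Dk psi0 psic unb.
(* A block with sum s in [e, 2 e] has measure at least 2 k s - 4 s ^ 2, and s <= k / 4 makes this at
   least k s. The 1/3 keeps psi below 1/2, where the intervals for one q are disjoint. *)
pose e : R := Num.min (k / 8) (1 / 3).
have e0 : 0 < e by rewrite lt_min !divr_gt0.
have ek : e <= k / 8 by rewrite ge_min lexx.
have e3 : e <= 1 / 3 by rewrite ge_min lexx orbT.
have [M0 HM0] := psic e e0.
pose F q : set R := if D q && (M0 <= q)%N then near_reduced R (psi q) q else set0.
have mF q : measurable (F q : set (measurableTypeR R)).
  by rewrite /F; case: ifP => _; [exact: measurable_near_reduced | exact: measurable0].
pose u q := if D q then psi q else 0.
have u0 q : 0 <= u q by rewrite /u; case: ifP.
have lamF q : (M0 <= q)%N -> ((2 * k * u q)%:E <= @lebesgue_measure R (F q))%E.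
  move=> Mq; rewrite /F /u Mq andbT; case: ifP => Dq; last by rewrite mulr0 measure0.
  rewrite lebesgue_near_reduced ?D0 //; last by have := HM0 _ Mq; lra.
  by rewrite lee_fin mulrAC; apply: ler_wpM2l; rewrite ?mulr_ge0 // Dk.
have lamFI q r : q != r -> (@lebesgue_measure R (F q `&` F r) <= (8 * u q * u r)%:E)%E.
  move=> qr; rewrite /F /u; case: (boolP (D q)) => Dq /=; last first.
    by rewrite set0I measure0 mulr0 mul0r.
  case: (boolP (D r)) => Dr /=; last by rewrite setI0 measure0 mulr0.
  case: ifP => _; last by rewrite set0I measure0 lee_fin !mulr_ge0.
  case: ifP => _; last by rewrite setI0 measure0 lee_fin !mulr_ge0.
  by apply: lebesgue_near_reducedI; rewrite ?D0.
have unbu B : exists N, B <= \sum_(0 <= q < N) u q.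
  by have [N hN] := unb B; exists N; rewrite big_mkcond in hN.
have tail M : (M0 <= M)%N ->
    ((e * k)%:E <= @lebesgue_measure R (\bigcup_(q >= M) F q))%E.
  move=> M0M.
  have ue q : (M <= q)%N -> u q <= e.
    move=> Mq; rewrite /u; case: ifP => _; last exact: ltW.
    by apply/ltW/HM0/(leq_trans M0M).
  have [n /andP[s1 s2]] := sum_block R u e M u0 ue unbu.
  set s := \sum_(i < n) u (M + i)%N in s1 s2.
  apply: (@le_trans _ _ (@lebesgue_measure R (\big[setU/set0]_(i < n) F (M + i)%N))); last first.
    apply: le_lebesgue; elim/big_ind: _ => // [A B|i _].
      by move=> HA HB x [/HA|/HB].
    by move=> x Fx; exists (M + i)%N => //=; exact: leq_addr.
  have bonf := bonferroni _ _ _ (@lebesgue_measure R) (fun i => F (M + i)%N) n (fun i => mF _).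
  have low : ((2 * k * s)%:E <= \sum_(i < n) @lebesgue_measure R (F (M + i)%N))%E.
    rewrite /s mulr_sumr -sumEFin; apply: lee_sum => i _; apply: lamF.
    by rewrite (leq_trans M0M) // leq_addr.
  have up : (\sum_(i < n) \sum_(j < i) @lebesgue_measure R (F (M + j)%N `&` F (M + i)%N) <=
      (4 * s ^+ 2)%:E)%E.
    apply: (@le_trans _ _ (8 * \sum_(i < n) \sum_(j < i) u (M + j)%N * u (M + i)%N)%:E).
      rewrite mulr_sumr -sumEFin; apply: lee_sum => i _.
      rewrite mulr_sumr -sumEFin; apply: lee_sum => j _.
      rewrite mulrA; apply: lamFI; rewrite eqn_add2l ltn_eqF //.
    rewrite lee_fin; have := sum_lower_pairs_le R (fun i => u (M + i)%N) n; rewrite -/s; lra.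
  set U := \big[setU/set0]_(i < n) F (M + i)%N in bonf *.
  have key (L : \bar R) : ((2 * k * s)%:E <= L + (4 * s ^+ 2)%:E)%E -> (0 <= L)%E ->
      ((e * k)%:E <= L)%E.
    case: L => [y| |]; [| by move=> _ _; rewrite leey | by move=> _; rewrite leeNy_eq].
    rewrite -EFinD !lee_fin => h _.
    have : s * k <= s * (2 * k - 4 * s) by apply: ler_wpM2l; lra.
    have : e * k <= s * k by rewrite ler_pM2r.
    nra.
  apply: key (measure_ge0 _ _); exact: le_trans low (le_trans bonf (leeD2l _ up)).
(* Continuity from above requires a union of finite measure. *)
have bounded : (@lebesgue_measure R (\bigcup_(q >= 0) F q) < +oo)%E.
  apply: (@le_lt_trans _ _ (@lebesgue_measure R `[-1, 2]%classic)); last first.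
    by rewrite lebesgue_measure_itv /= lte_fin; case: ifP => _; rewrite -?EFinB ltry.
  apply: le_lebesgue => x [q _]; rewrite /F; case: ifP => // /andP[Dq Mq].
  have q0 := D0 q Dq; move=> /near_reducedP[a /andP[aq _] /near_fractionP -/(_ q0)].
  have q1 : 1 <= q%:R :> R by rewrite ler1n.
  have a0 : a%:R + 1 <= q%:R :> R by rewrite natr1 ler_nat.
  have a0' : 0 <= a%:R :> R by [].
  have psi1 := HM0 q Mq.
  rewrite ler_norml /= in_itv /= => /andP[h1 h2]; apply/andP; split.
    rewrite leNgt; apply/negP => x1; nra.
  rewrite leNgt; apply/negP => x1; nra.
exists (lim_sup_set F); split.
- apply: bigcap_measurable => // n _.
  by apply: bigcup_measurable => q _; exact: mF.
- apply: (@lt_le_trans _ _ (e * k)%:E); first by rewrite lte_fin mulr_gt0.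
  have cv := lim_sup_set_cvg (@lebesgue_measure R) F mF bounded.
  have <- := cvg_lim (@ereal_hausdorff R) cv.
  apply: lime_ge; first by apply/cvg_ex; eexists; exact: cv.
  by exists M0 => // M /= M0M; exact: tail.
- move=> x Vx M; have [q /= Mq Fq] := Vx M I; exists q.
  move: Fq; rewrite /F; case: ifP => // /andP[Dq _] /near_reducedP[a _ h]; split => //.
  by exists a; apply/near_fractionP; rewrite ?D0.
Qed.

(** Summation by parts, as an induction on (A_n + K) psi_n - K psi_1 <= sum of a psi, with A_n the
    partial sum of [a]. Applied to the indicator of [D] minus [c], it transfers divergence to the
    sum along [D]. *)
Lemma abel_summation_ge (R : realFieldType) (a psi : nat -> R) (K : R) n :
  (forall q, (0 < q)%N -> 0 <= psi q) -> (forall q, (0 < q)%N -> psi q.+1 <= psi q) ->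
  (forall n, - K <= \sum_(1 <= d < n.+1) a d) ->
  - K * psi 1%N <= \sum_(1 <= d < n.+1) a d * psi d.
Proof.
move=> psi0 psid Ka.
have K0 : 0 <= K by have := Ka 0%N; rewrite big_nil; lra.
case: n => [|n]; first by rewrite big_nil mulNr oppr_le0 mulr_ge0 ?psi0.
suff : (\sum_(1 <= d < n.+2) a d + K) * psi n.+1 - K * psi 1%N <=
    \sum_(1 <= d < n.+2) a d * psi d.
  have : 0 <= (\sum_(1 <= d < n.+2) a d + K) * psi n.+1.
    by rewrite mulr_ge0 ?psi0 // -lerBlDr sub0r Ka.
  lra.
elim: n => [|n IH]; first by rewrite !big_nat1; lra.
rewrite !(big_nat_recr n.+2) //=.
have h : (\sum_(1 <= d < n.+2) a d + K) * psi n.+2 <=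
    (\sum_(1 <= d < n.+2) a d + K) * psi n.+1.
  by apply: ler_wpM2l; rewrite ?psid // -lerBlDr sub0r Ka.
move: IH h; move: (\sum_(1 <= d < n.+2) a d) (\sum_(1 <= d < n.+2) a d * psi d) => s t; lra.
Qed.

(** Once the partial sum has grown from S_M to S_N >= 1 + 2 S_M, the new terms add at least (S_N -
    S_M) / (1 + S_N) >= 1/2. *)
Lemma abel_dini (R : realFieldType) (eta : nat -> R) :
  (forall q, (0 < q)%N -> 0 <= eta q) ->
  (forall B, exists N, B <= \sum_(1 <= q < N.+1) eta q) ->
  forall n : nat, exists N,
    n%:R / 2 <= \sum_(1 <= q < N.+1) eta q / (1 + \sum_(1 <= i < q.+1) eta i).
Proof.
move=> eta0 unb; pose S n := \sum_(1 <= q < n.+1) eta q.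
have S0 n : 0 <= S n.
  by rewrite /S big_nat; apply: sumr_ge0 => q /andP[q0 _]; exact: eta0.
have Smono m n : (m <= n)%N -> S m <= S n.
  move=> mn; rewrite /S [leRHS](big_cat_nat (n := m.+1)) //= lerDl big_nat.
  by apply: sumr_ge0 => q /andP[mq _]; apply: eta0; apply: leq_trans mq.
elim=> [|n [M IH]]; first by exists 0%N; rewrite big_nil mul0r.
have [N0 hN0] := unb (1 + 2 * S M); pose N := maxn N0 M; exists N.
have MN : (M <= N)%N by rewrite leq_maxr.
have SN : 1 + 2 * S M <= S N by apply: (le_trans hN0); apply: Smono; rewrite leq_maxl.
have SN1 : 0 < 1 + S N by have := S0 N; lra.
rewrite (big_cat_nat (n := M.+1)) //= -natr1 mulrDl; apply: lerD; first exact: IH.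
apply: (@le_trans _ _ (\sum_(M.+1 <= q < N.+1) eta q / (1 + S N))).
  rewrite -mulr_suml ler_pdivlMr //.
  have -> : \sum_(M.+1 <= q < N.+1) eta q = S N - S M.
    by rewrite /S [X in _ = X - _](big_cat_nat (n := M.+1)) //= addrAC subrr add0r.
  lra.
rewrite [leLHS]big_nat [leRHS]big_nat; apply: ler_sum => q /andP[Mq qN].
apply: ler_wpM2l; first by apply: eta0; apply: leq_trans Mq.
rewrite -/(S q) lef_pV2 ?posrE //; last by have := S0 q; lra.
by rewrite lerD2l; apply: Smono.
Qed.

Lemma khintchine_dense (R : realType) (D : pred nat) (k c : R) (eta : nat -> R) :
  0 < k -> 0 < c -> (forall q, D q -> (0 < q)%N) -> (forall q, D q -> k <= phi_ratio R q) ->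
  (exists N0, forall N, (N0 <= N)%N -> c * N%:R <= \sum_(1 <= d < N) (D d)%:R) ->
  (forall q, (0 < q)%N -> 0 <= eta q) -> (forall q, (0 < q)%N -> eta q.+1 <= eta q) ->
  (forall B, exists N, B <= \sum_(1 <= q < N.+1) eta q) ->
  @lebesgue_measure R (`[0, 1]%classic `\` [set x | forall M, exists q, [/\ (M <= q)%N, D q &
    exists a : int, `|q%:R * x - a%:~R| <= eta q]]) = 0%E.
Proof.
move=> k0 c0 D0 Dk [N0 dens] eta0 etad unb.
pose S n := \sum_(1 <= q < n.+1) eta q.
have S0 n : 0 <= S n.
  by rewrite /S big_nat; apply: sumr_ge0 => q /andP[q0 _]; exact: eta0.
have Smono m n : (m <= n)%N -> S m <= S n.
  move=> mn; rewrite /S [leRHS](big_cat_nat (n := m.+1)) //= lerDl big_nat.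
  by apply: sumr_ge0 => q /andP[mq _]; apply: eta0; apply: leq_trans mq.
have S1 n : 0 < 1 + S n by have := S0 n; lra.
pose psi q := if q is 0%N then 0 else eta q / (1 + S q).
have psiE q : (0 < q)%N -> psi q = eta q / (1 + S q) by case: q.
have psi0 q : 0 <= psi q.
  by case: q => [|q] //=; rewrite divr_ge0 ?eta0 // ltW.
have psid q : (0 < q)%N -> psi q.+1 <= psi q.
  move=> q0; rewrite !psiE //; apply: ler_pM; rewrite ?eta0 ?invr_ge0 ?(ltW (S1 _)) ?etad //.
  by rewrite lef_pV2 ?posrE // lerD2l Smono.
have psi_eta (K : R) : exists M, forall q, (M <= q)%N -> (0 < q)%N -> K * psi q <= eta q.
  have [M hM] := unb K; exists M => q Mq q0.
  rewrite psiE // mulrA ler_pdivrMr // mulrC; apply: ler_wpM2l; first exact: eta0.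
  by apply: (le_trans hM); have := Smono _ _ Mq; rewrite -/(S M); lra.
have eta1 q : (0 < q)%N -> eta q <= eta 1%N.
  by elim: q => // -[|q] IH _ //; apply: le_trans (etad _ _) (IH _).
have psic e : 0 < e -> exists M, forall q, (M <= q)%N -> psi q < e.
  move=> e0; have [M hM] := psi_eta ((1 + eta 1%N) / e); exists M => q Mq.
  case: (posnP q) => [->|q0]; first exact: e0.
  have := hM q Mq q0; have := eta1 q q0; have := eta0 1%N isT => h0 h1 h2.
  have : (1 + eta 1%N) / e * psi q < 1 + eta 1%N by lra.
  rewrite mulrAC ltr_pdivrMr // ltr_pM2l //; lra.
have unbpsi B : exists N, B <= \sum_(1 <= q < N.+1) psi q.
  have [N hN] := abel_dini R eta eta0 unb (Num.truncn (2 * `|B|)).+1.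
  exists N; rewrite (eq_big_nat _ _ (F2 := fun q => eta q / (1 + S q))); last first.
    by move=> q /andP[q0 _]; exact: psiE.
  apply: le_trans hN; have := truncn_itv (_ : 0 <= 2 * `|B|).
  rewrite mulr_ge0 // => /(_ isT) /andP[_]; have := ler_norm B; lra.
(* The density bound is available only from [N0] on; before that the partial sum is at least - c n,
   which the constant covers. *)
have Dlow n : - (c * (N0%:R + 1)) <= \sum_(1 <= d < n.+1) ((D d)%:R - c).
  rewrite sumrB sumr_const_nat subn1 /= -mulr_natr.
  have h0 : 0 <= \sum_(1 <= d < n.+1) (D d)%:R :> R by apply: sumr_ge0.
  have [h|h] := leqP N0 n.+1.
    have := dens _ h; rewrite -natr1 => h1.
    have : 0 <= c * (N0%:R + 1) by rewrite mulr_ge0 ?addr_ge0 // ltW.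
    lra.
  have : c * n%:R <= c * (N0%:R + 1).
    by rewrite ler_pM2l // natr1 ler_nat; lia.
  lra.
have unbD B : exists N, B <= \sum_(0 <= q < N | D q) psi q.
  have [N hN] := unbpsi ((B + c * (N0%:R + 1) * psi 1%N) / c); exists N.+1.
  have -> : \sum_(0 <= q < N.+1 | D q) psi q = \sum_(1 <= q < N.+1) (D q)%:R * psi q.
    rewrite big_mkcond [LHS]big_ltn //= (_ : (if D 0%N then _ else _) = 0) ?add0r; last by case: ifP.
    by apply: eq_bigr => q _; case: (D q); rewrite ?mul1r ?mul0r.
  have := abel_summation_ge R (fun d => (D d)%:R - c) psi (c * (N0%:R + 1)) N
    (fun q _ => psi0 q) psid Dlow.
  under eq_bigr do rewrite mulrBl.
  rewrite sumrB -mulr_sumr; rewrite ler_pdivrMr // in hN.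
  move: hN; move: (\sum_(1 <= q < N.+1) psi q) (\sum_(1 <= q < N.+1) _) (psi 1%N) => s t p.
  lra.
have [V [mV V0 VP]] := limsup_positive R D k psi k0 D0 Dk psi0 psic unbD.
pose W := [set x : R | exists K : nat, forall M, exists q, [/\ (M <= q)%N, D q &
    exists a : int, `|q%:R * x - a%:~R| <= K%:R * psi q]].
have W01 : @lebesgue_measure R (`[0, 1]%classic `\` W) = 0%E.
  apply: (zero_one_law R V) => //.
  - move=> x Vx; exists 1%N => M; have [q [Mq Dq [a ha]]] := VP x Vx M.
    by exists q; split => //; exists a; rewrite mul1r.
  - move=> x n n0 [K hK]; exists (n * K)%N => M; have [q [Mq Dq [a ha]]] := hK M.
    exists q; split => //; exists (n%:Z * a).
    rewrite intrM -[n%:~R]/(n%:R) (_ : _ - _ = n%:R * (q%:R * x - a%:~R)); last by ring.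
    by rewrite normrM normr_nat natrM -mulrA ler_wpM2l.
  - move=> x m [K hK]; exists K => M; have [q [Mq Dq [a ha]]] := hK M.
    exists q; split => //; exists (a + q%:Z * m).
    rewrite intrD intrM -[q%:~R]/(q%:R).
    by rewrite (_ : _ - _ = q%:R * x - a%:~R) //; ring.
apply/eqP; rewrite eq_le measure_ge0 andbT -W01; apply: le_lebesgue.
move=> x [x01 nx]; split => // -[K hK]; apply: nx => M.
have [M1 hM1] := psi_eta K%:R.
have [q [Mq Dq [a ha]]] := hK (maxn M M1).
move: Mq; rewrite geq_max => /andP[Mq M1q].
exists q; split => //; exists a; apply: (le_trans ha); apply: hM1 => //; exact: D0.
Qed.

(** * Minimal gaps *)

Lemma primes_belowS n : primes_below n.+1 = (primes_below n + prime n)%N.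
Proof. by rewrite /primes_below big_ord_recr. Qed.

Lemma primes_below_mono m n : (m <= n)%N -> (primes_below m <= primes_below n)%N.
Proof. by move=> mn; rewrite /primes_below -(subnKC mn) big_split_ord /= leq_addr. Qed.

(** With [nth_prime_primes_below] this makes counting and indexing inverse to each other, so that
    Chebyshev's bounds apply to the N-th prime. *)
Lemma primes_below_nth_prime n : primes_below (nth_prime n).+1 = n.
Proof.
elim: n => [|n IH]; first by rewrite /primes_below big_ord_recl big_ord0.
rewrite /= /next_prime; case: ex_minnP => p /andP[np pp] pmin.
rewrite primes_belowS pp addn1; congr _.+1; rewrite -[RHS]IH.
rewrite /primes_below -(subnKC np) big_split_ord /= [X in (_ + X)%N]big1 ?addn0 // => i _.
apply/eqP; rewrite eqb0; apply/negP => pi.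
have := pmin ((nth_prime n).+1 + i)%N; rewrite pi andbT addSn ltnS leq_addr => /(_ isT).
by have := ltn_ord i; lia.
Qed.

Lemma nth_prime_primes_below p : prime p -> nth_prime (primes_below p.+1) = p.
Proof.
move=> pp; set n := primes_below p.+1.
have n0 : (0 < n)%N by rewrite /n primes_belowS pp addn1.
have pn : prime (nth_prime n).
  by case: n n0 => // n _ /=; rewrite /next_prime; case: ex_minnP => q /andP[].
have e := primes_below_nth_prime n.
apply/eqP; rewrite eqn_leq; apply/andP; split; rewrite leqNgt; apply/negP => lt.
  by have := primes_below_mono _ _ lt; rewrite -/n primes_belowS pn in e *; lia.
have := primes_below_mono _ _ lt; rewrite e.
by have : n = (primes_below p + 1)%N; [rewrite /n primes_belowS pp|lia].
Qed.

Lemma nth_prime_mono m n : (m <= n)%N -> (nth_prime m <= nth_prime n)%N.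
Proof.
elim: n => [|n IH]; first by rewrite leqn0 => /eqP ->.
rewrite leq_eqVlt => /predU1P[-> //|]; rewrite ltnS => /IH h; apply: (leq_trans h).
by rewrite /= /next_prime; case: ex_minnP => p /andP[/ltnW].
Qed.

Lemma nth_prime_inj : injective nth_prime.
Proof. by move=> m n e; rewrite -(primes_below_nth_prime m) e primes_below_nth_prime. Qed.

Lemma dist_nintP (R : realType) (x t : R) :
  dist_nint x <= t <-> exists a : int, `|x - a%:~R| <= t.
Proof.
have /andP[f1 f2] := floor_itv x; rewrite intrD in f2.
rewrite /dist_nint ge_min; split.
  case/orP => h; [exists (Num.floor x)|exists (Num.floor x + 1)].
    by rewrite ger0_norm // subr_ge0.
  by rewrite intrD distrC ger0_norm ?subr_ge0 // ltW.
case=> a; rewrite ler_norml => /andP[h1 h2]; apply/orP.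
have [h|h] := leP a (Num.floor x).
  by left; have : a%:~R <= (Num.floor x)%:~R :> R; [rewrite ler_int | lra].
right; have : (Num.floor x + 1)%:~R <= a%:~R :> R by rewrite ler_int lezD1.
rewrite intrD; lra.
Qed.

(** [t < 1] excludes the neutral element 1 of the minimum. *)
Lemma bigmin_le_ex (R : realType) (s : seq nat) (P : pred nat) (F : nat -> R) t :
  t < 1 -> \big[Num.min/1]_(i <- s | P i) F i <= t ->
  exists i, [/\ i \in s, P i & F i <= t].
Proof.
move=> t1; elim: s => [|i s IH]; first by rewrite big_nil leNgt t1.
rewrite big_cons; case: ifP => Pi; last first.
  by move=> /IH[j [js Pj Fj]]; exists j; rewrite inE js orbT.
rewrite ge_min => /orP[Fi|/IH[j [js Pj Fj]]].
  by exists i; rewrite inE eqxx.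
by exists j; rewrite inE js orbT.
Qed.

Lemma bigmin_le_mem (R : realType) (s : seq nat) (P : pred nat) (F : nat -> R) i :
  i \in s -> P i -> \big[Num.min/1]_(i <- s | P i) F i <= F i.
Proof.
move=> + Pi; elim: s => [//|j s IH]; rewrite inE big_cons => /predU1P[<-|/IH h].
  by rewrite Pi ge_min lexx.
by case: ifP => _; rewrite ?ge_min h ?orbT.
Qed.

Lemma delta_min_le (R : realType) (x : R) N m n : (0 < m <= N)%N -> (0 < n <= N)%N -> m != n ->
  delta_min x N <= dist_nint (((nth_prime m)%:R - (nth_prime n)%:R) * x).
Proof.
move=> mN nN mn; rewrite /delta_min.
apply: le_trans (bigmin_le_mem _ _ _ _ m _ isT) _; first by rewrite mem_index_iota ltnS.
by apply: (bigmin_le_mem _ _ _ (fun n => dist_nint (((nth_prime m)%:R - (nth_prime n)%:R) * x)));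
   rewrite ?mem_index_iota ?ltnS.
Qed.

Lemma delta_min_ex (R : realType) (x t : R) N : t < 1 -> delta_min x N <= t ->
  exists d, (0 < d <= nth_prime N)%N /\ exists a : int, `|d%:R * x - a%:~R| <= t.
Proof.
move=> t1 /(bigmin_le_ex _ _ _ _ _ t1)[m [mN _ /(bigmin_le_ex _ _ _ _ _ t1)[n [nN mn]]]].
move: mN nN; rewrite !mem_index_iota !ltnS => /andP[_ mN] /andP[_ nN] /dist_nintP[a ha].
have := nth_prime_mono _ _ mN; have := nth_prime_mono _ _ nN => hn hm.
have ne : nth_prime m != nth_prime n by apply: contra mn => /eqP /nth_prime_inj ->.
have [le|lt] := leqP (nth_prime n) (nth_prime m).
  exists (nth_prime m - nth_prime n)%N; split; first by lia.
  by exists a; rewrite natrB.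
exists (nth_prime n - nth_prime m)%N; split; first by lia.
exists (- a); rewrite natrB ?(ltnW lt) // intrN.
rewrite (_ : _ - - _ = - (((nth_prime m)%:R - (nth_prime n)%:R) * x - a%:~R)); last by ring.
by rewrite normrN.
Qed.

(** * Comparison of the N-th prime with N log N *)

Definition floor_nlogn (R : realType) (N : nat) : nat :=
  `|Num.floor (N%:R * logm (N%:R : R))|%N.

Lemma logm_ge1 (R : realType) (x : R) : 1 <= logm x.
Proof. by rewrite /logm le_max lexx. Qed.

Lemma floor_nlogn_itv (R : realType) N :
  ((floor_nlogn R N)%:R : R) <= N%:R * logm (N%:R : R) < (floor_nlogn R N)%:R + 1.
Proof.
have h0 : 0 <= N%:R * logm (N%:R : R) :> R by rewrite mulr_ge0 // (le_trans ler01) // logm_ge1.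
have f0 : 0 <= Num.floor (N%:R * logm (N%:R : R) : R) by rewrite floor_ge0.
have := floor_itv (N%:R * logm (N%:R : R) : R); rewrite intrD.
by rewrite /floor_nlogn natr_absz ger0_norm.
Qed.

Lemma floor_nlogn_ge (R : realType) N : (N <= floor_nlogn R N)%N.
Proof.
rewrite -ltnS -(ltr_nat R) -natr1; have /andP[_ h] := floor_nlogn_itv R N.
by apply: le_lt_trans h; rewrite ler_peMr // logm_ge1.
Qed.

(** Constants are rounded up to powers of 2, the dilations that iterating the doubling hypothesis
    provides. *)
Lemma ex_pow2_ge (R : realType) (x : R) : exists k : nat, x <= (2 ^ k)%:R.
Proof.
exists (Num.truncn `|x|).+1; apply: le_trans (ler_norm x) _.
have /andP[_ h] := truncn_itv (normr_ge0 x); apply: (le_trans (ltW h)).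
by rewrite ler_nat ltnW // ltn_expl.
Qed.

(** With X = p_N + 1, Chebyshev's lower bound reads c X <= N ln X. Inserting ln X = O(sqrt X) first
    gives the crude X = O(N ^ 2), hence ln X = O(log N), and then the claim. *)
Lemma nth_prime_le_floor_nlogn (R : realType) :
  exists k, forall N, (1 < N)%N -> (nth_prime N <= 2 ^ k * floor_nlogn R N)%N.
Proof.
have [c c0 low] := primes_below_lower R.
pose C : R := 2 + `|ln (4 / c ^+ 2)|.
have [k hk] := ex_pow2_ge R (2 * (C / c)); exists k => N N1.
set X := (nth_prime N).+1; have XN : primes_below X = N := primes_below_nth_prime N.
have X3 : (2 < X)%N.
  rewrite ltnNge; apply/negP => X2; have := primes_below_mono _ _ X2.
  by rewrite XN /primes_below !big_ord_recl big_ord0 /=; lia.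
have X0 : 0 < X%:R :> R by rewrite ltr0n.
have N0 : 0 < N%:R :> R by rewrite ltr0n; lia.
have l0 : 0 < ln X%:R :> R by rewrite ln_gt0 // ltr1n; lia.
have lowX := low X X3; rewrite XN mulrA ler_pdivrMr // in lowX.
have XN2 : X%:R <= 4 / c ^+ 2 * N%:R ^+ 2.
  have hX := sqr_ln_le R X%:R; rewrite ler1n in hX; have {}hX := hX isT.
  have : (c * X%:R) ^+ 2 <= (N%:R * ln X%:R) ^+ 2.
    by rewrite ler_sqr ?nnegrE ?mulr_ge0 ?(ltW c0) ?(ltW l0).
  rewrite !exprMn => h.
  have : c ^+ 2 * X%:R ^+ 2 <= N%:R ^+ 2 * (4 * X%:R).
    by apply: (le_trans h); rewrite ler_wpM2l ?sqr_ge0.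
  have -> : 4 / c ^+ 2 * N%:R ^+ 2 = 4 * N%:R ^+ 2 / c ^+ 2 by ring.
  by move=> h2; rewrite ler_pdivlMr ?exprn_gt0 // -(ler_pM2r X0); lra.
have lnX : ln X%:R <= C * logm (N%:R : R).
  apply: (@le_trans _ _ (ln (4 / c ^+ 2 * N%:R ^+ 2))).
    by rewrite ler_ln ?posrE ?mulr_gt0 ?invr_gt0 ?exprn_gt0.
  rewrite lnM ?posrE ?divr_gt0 ?exprn_gt0 // lnXn // /C.
  have g1 := logm_ge1 R N%:R.
  have g2 : ln N%:R <= logm (N%:R : R) :> R by rewrite /logm le_max lexx orbT.
  have := ler_norm (ln (4 / c ^+ 2)).
  have : `|ln (4 / c ^+ 2)| <= `|ln (4 / c ^+ 2)| * logm (N%:R : R) by rewrite ler_peMr.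
  lra.
have /andP[_ fl] := floor_nlogn_itv R N.
have f1 : 1 <= (floor_nlogn R N)%:R :> R.
  by rewrite ler1n (leq_trans _ (floor_nlogn_ge R N)) // ltnW.
have C0 : 0 < C by rewrite /C; have := normr_ge0 (ln (4 / c ^+ 2)); lra.
rewrite -(ler_nat R) natrM; apply: (@le_trans _ _ X%:R); first by rewrite ler_nat /X.
apply: (@le_trans _ _ (2 * (C / c) * (floor_nlogn R N)%:R)); last by rewrite ler_wpM2r.
rewrite -(ler_pM2l c0); apply: (le_trans lowX).
have -> : c * (2 * (C / c) * (floor_nlogn R N)%:R) = C * (2 * (floor_nlogn R N)%:R).
  by field; rewrite gt_eqF.
apply: (@le_trans _ _ (N%:R * (C * logm (N%:R : R)))); first by rewrite ler_pM2l.
rewrite mulrCA ler_pM2l //; lra.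
Qed.

(** The logarithm of the count is at most ln(p + 1), and dividing by ln 2 also covers [logm] = 1,
    since p + 1 >= 2. The factor ln(p + 1) then cancels against Chebyshev's upper bound. *)
Lemma floor_nlogn_primes_below_le (R : realType) :
  exists k, forall p, (0 < p)%N -> (floor_nlogn R (primes_below p.+1) <= 2 ^ k * p)%N.
Proof.
have [C C0 up] := primes_below_upper R.
have l2 : 0 < ln 2 :> R by rewrite ln_gt0 // ltr1n.
have l21 : ln 2 <= 1 :> R by apply: (@le_ln1Dx R 1); lra.
have [k hk] := ex_pow2_ge R (2 * C / ln 2); exists k => p p0.
set N := primes_below p.+1.
have P0 : 0 < p.+1%:R :> R by [].
have l0 : 0 < ln p.+1%:R :> R by rewrite ln_gt0 // ltr1n.
have lp : ln 2 <= ln p.+1%:R :> R by rewrite ler_ln ?posrE // ler_nat.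
have hN : N%:R <= C * (p.+1%:R / ln p.+1%:R) :> R by exact: up.
have hl : logm (N%:R : R) <= ln p.+1%:R / ln 2 :> R.
  rewrite /logm ge_max !ler_pdivlMr // mul1r lp /=.
  have [->|N0] := posnP N; first by rewrite ln0 // mul0r ltW.
  apply: (@le_trans _ _ (ln N%:R * 1)).
    by rewrite ler_wpM2l // ln_ge0 // ler1n.
  by rewrite mulr1 ler_ln ?posrE ?ltr0n // ler_nat primes_below_le.
have /andP[fl _] := floor_nlogn_itv R N.
rewrite -(ler_nat R) natrM; apply: (le_trans fl).
apply: (@le_trans _ _ (C * (p.+1%:R / ln p.+1%:R) * (ln p.+1%:R / ln 2))).
  by apply: ler_pM => //; rewrite (le_trans ler01) // logm_ge1.
have -> : C * (p.+1%:R / ln p.+1%:R) * (ln p.+1%:R / ln 2) = C / ln 2 * p.+1%:R.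
  by field; rewrite !gt_eqF.
apply: (@le_trans _ _ (2 * C / ln 2 * p%:R)); last by rewrite ler_wpM2r.
have -> : 2 * C / ln 2 * p%:R = C / ln 2 * (2 * p%:R) by ring.
rewrite ler_pM2l ?divr_gt0 // -natrM ler_nat; lia.
Qed.

Lemma doubling_pow2 (R : realType) (eta : nat -> R) (c0 : R) k n : 0 < c0 ->
  (forall n, (0 < n)%N -> 0 < eta n) ->
  (forall n, (0 < n)%N -> c0 <= eta (2 * n)%N / eta n) ->
  (0 < n)%N -> c0 ^+ k * eta n <= eta (2 ^ k * n)%N.
Proof.
move=> c0p eta0 dbl n0; elim: k => [|k IH]; first by rewrite expr0 expn0 mul1r mul1n.
have m0 : (0 < 2 ^ k * n)%N by rewrite muln_gt0 expn_gt0.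
have := dbl _ m0; rewrite ler_pdivlMr ?eta0 // mulnA -expnS; apply: le_trans.
by rewrite exprS -mulrA ler_pM2l.
Qed.

Lemma antitone_nat (R : realType) (eta : nat -> R) m n :
  (forall N : nat, (1 <= N)%N -> eta N.+1 < eta N) ->
  (0 < m)%N -> (m <= n)%N -> eta n <= eta m.
Proof.
move=> dec m0; elim: n => [|n IH]; first by rewrite leqn0 => /eqP ->.
rewrite leq_eqVlt => /predU1P[-> //|]; rewrite ltnS => mn.
by apply: le_trans (ltW (dec n _)) (IH mn); apply: leq_trans mn.
Qed.

(** Finitely many positive distances have a positive minimum. This prevents a few small differences
    from serving infinitely many N. *)
Lemma near_int_gap (R : realType) (x : R) M :
  (forall d, (0 < d < M)%N -> ~ exists a : int, d%:R * x = a%:~R) ->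
  exists2 e : R, 0 < e & forall d, (0 < d < M)%N -> forall a : int, e <= `|d%:R * x - a%:~R|.
Proof.
elim: M => [|M IH] H; first by exists 1 => // d /andP[_]; rewrite ltn0.
have [d dM|e e0 he] := IH; first by apply: H; lia.
have [M0|M0] := posnP M; first by exists e => // d; lia.
pose f := dist_nint (M%:R * x).
have f0 : 0 < f.
  rewrite ltNge; apply/negP => /dist_nintP[a]; rewrite normr_le0 subr_eq0 => /eqP ha.
  by apply: (H M); [rewrite M0 ltnSn | exists a].
exists (Num.min e f); first by rewrite lt_min e0.
move=> d /andP[d0]; rewrite ltnS leq_eqVlt => /predU1P[->|dM] a.
  by rewrite ge_min; apply/orP; right; apply/dist_nintP; exists a.
by rewrite ge_min he ?d0.
Qed.

(** Borel-Cantelli for the d + 1 intervals around a / d with 0 <= a <= d, of total length at most 4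
    C eta(d). For x in [0, 1], the condition C eta(d) < 1 confines a to this range. *)
Lemma convergent_null (R : realType) (eta : nat -> R) (C B : R) :
  0 <= C -> (forall d, (0 < d)%N -> 0 <= eta d) ->
  (forall n, \sum_(1 <= k < n) eta k <= B) ->
  exists F : nat -> set R,
    @lebesgue_measure R (lim_sup_set F) = 0%E /\
    forall d x, (0 < d)%N -> C * eta d < 1 -> 0 <= x <= 1 ->
      (exists a : int, `|d%:R * x - a%:~R| <= C * eta d) -> F d x.
Proof.
move=> C0 eta0 etaB.
pose F d : set R := if d is 0%N then set0 else
  \big[setU/set0]_(a < d.+1) near_fraction R (C * eta d) d a.
have mF d : measurable (F d : set (measurableTypeR R)).
  by case: d => [|d] //=; apply: bigsetU_measurable => a _; exact: measurable_itv.
have lamF d : (0 < d)%N -> (@lebesgue_measure R (F d) <= (4 * C * eta d)%:E)%E.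
  case: d => // d _; rewrite [F _]/=; set n := d.+1.
  apply: le_trans (lebesgue_bigU_le _ _ _ _ _) _.
  rewrite (eq_bigr (fun=> (2 * (C * eta n) / n%:R)%:E)); last first.
    by move=> a _; apply: lebesgue_near_fraction => //; rewrite mulr_ge0 ?eta0.
  rewrite sumEFin sumr_const card_ord lee_fin -[leLHS]mulr_natr -/n.
  have n0 : 0 < n%:R :> R by [].
  have -> : 4 * C * eta n = 2 * (C * eta n) * 2 by ring.
  rewrite -[leLHS]mulrA; apply: ler_wpM2l; first by rewrite !mulr_ge0 ?eta0.
  by rewrite mulrC ler_pdivrMr // -natrM ler_nat /n; lia.
exists F; split.
  apply: lim_sup_set_cvg0 => //.
  apply: (@le_lt_trans _ _ (4 * C * B)%:E); last exact: ltry.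
  apply: lime_le; first by apply: is_cvg_nneseries.
  apply: nearW => n; apply: (@le_trans _ _ (4 * C * \sum_(1 <= k < n) eta k)%:E).
    rewrite mulr_sumr -sumEFin; case: n => [|n]; first by rewrite !big_geq.
    rewrite big_ltn //= measure0 add0e big_nat [leRHS]big_nat.
    by apply: lee_sum => d /andP[d0 _]; exact: lamF.
  by rewrite lee_fin; apply: ler_wpM2l; rewrite ?mulr_ge0.
move=> d x d0 Cd /andP[x0 x1] [a ha].
have d1 : 0 < d%:R :> R by rewrite ltr0n.
have dx0 : 0 <= d%:R * x by rewrite mulr_ge0.
have dx1 : d%:R * x <= d%:R by rewrite ler_piMr.
move: (ha); rewrite ler_norml => /andP[h1 h2].
have a0 : (0 <= a)%R.
  by rewrite -ltzD1 -(ltr_int R) intrD; lra.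
have ad : (`|a| < d.+1)%N.
  rewrite ltnS -(ler_nat R) natr_absz ger0_norm //.
  have : a < d%:Z + 1 by rewrite -(ltr_int R) intrD -[d%:~R]/(d%:R); lra.
  by rewrite ltzD1 -(ler_int R).
case: d d0 d1 Cd ha ad {h1 h2 dx0 dx1} => // d _ d1 Cd ha ad.
rewrite [F _]/= (bigD1 (Ordinal ad)) //=; left.
by apply: (near_fractionP R _ d.+1 _ x isT).2; rewrite natr_absz (ger0_norm a0).
Qed.

Theorem theorem4 (R : realType) (eta : nat -> R) (c0 : R) :
  (forall N : nat, (1 <= N)%N -> eta N.+1 < eta N) ->
  (forall N : nat, (1 <= N)%N -> 0 <= eta N) ->
  0 < c0 ->
  (forall N : nat, (1 <= N)%N -> c0 <= eta (2 * N)%N / eta N) ->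
  let A := [set alpha : R | 0 <= alpha <= 1 /\
              forall M : nat, exists N : nat, (M <= N)%N /\ (2 <= N)%N /\
                delta_min alpha N <=
                  eta `|Num.floor (N%:R * logm (N%:R : R))|%N] in
  (cvg ((fun n : nat => \sum_(1 <= k < n) eta k) @ \oo) ->
     (@lebesgue_measure R A = (0%:E))) /\
  (~ cvg ((fun n : nat => \sum_(1 <= k < n) eta k) @ \oo) ->
     (@lebesgue_measure R A = (1%:E))).
Proof.
move=> dec nonneg c0p dbl A.
have eta0 n : (0 < n)%N -> 0 < eta n.
  by move=> n0; apply: le_lt_trans (dec n n0); apply: nonneg.
pose u n := \sum_(1 <= k < n) eta k.
have uS n : u n <= u n.+1.
  case: n => [|n]; first by rewrite /u !big_geq.
  by rewrite /u [leRHS]big_nat_recr //= lerDl ltW ?eta0.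
have ndu : nondecreasing_seq u by apply/nondecreasing_seqP.
split=> [ucvg|nucvg].
  have uB n : u n <= limn u by exact: nondecreasing_cvgn_le.
  set B := limn u in uB.
  have [k hk] := nth_prime_le_floor_nlogn R.
  (* For d <= p_N <= 2 ^ k L, doubling and monotonicity give eta(L) <= C eta(2 ^ k L) <= C
     eta(d). *)
  pose C : R := (c0 ^+ k)^-1.
  have C0 : 0 < C by rewrite invr_gt0 exprn_gt0.
  have [F [F0 FP]] := convergent_null R eta C B (ltW C0) nonneg uB.
  apply/eqP; rewrite eq_le measure_ge0 andbT -[leRHS]F0; apply: le_lebesgue.
  (* By monotonicity n eta(n) is at most a partial sum, hence at most [B]. *)
  have small e : 0 < e -> exists M, (0 < M)%N /\ forall n, (M <= n)%N -> eta n < e.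
    move=> e0; exists (Num.truncn (`|B| / e)).+1; split => // n Mn.
    have n0 : (0 < n)%N by apply: leq_trans Mn.
    have /andP[_ h] := truncn_itv (divr_ge0 (normr_ge0 B) (ltW e0)).
    have {h} hB : `|B| < n%:R * e.
      by rewrite -ltr_pdivrMr //; apply: lt_le_trans h _; rewrite ler_nat.
    rewrite -(ltr_pM2l (_ : 0 < n%:R)) ?ltr0n //; apply: le_lt_trans hB.
    apply: le_trans (ler_norm B); apply: le_trans (uB n.+1).
    have -> : n%:R * eta n = \sum_(1 <= q < n.+1) eta n.
      by rewrite sumr_const_nat subn1 mulr_natl.
    rewrite /u big_nat [leRHS]big_nat; apply: ler_sum => q /andP[q0 qn].
    by apply: antitone_nat.
  (* Suppose [x] avoids [F d] for all d >= M. A difference attaining the minimum for a large N is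
     then either large, which [far] forbids, or one of finitely many small ones, which keep a
     distance [e] from the integers. *)
  move=> x [x01 xA] M _; apply: contrapT => nF.
  have {}nF d : (M <= d)%N -> ~ F d x by move=> Md Fd; apply: nF; exists d.
  have Cinv0 : 0 < C^-1 by rewrite invr_gt0.
  have [M1 [M10 hM1]] := small _ Cinv0.
  pose M2 := maxn M M1.
  have far d (a : int) : (M2 <= d)%N -> C * eta d < `|d%:R * x - a%:~R|.
    rewrite geq_max => /andP[Md M1d]; have d0 : (0 < d)%N by apply: leq_trans M1d.
    rewrite ltNge; apply/negP => h; apply: (nF d Md); apply: FP => //; last by exists a.
    by rewrite mulrC -ltr_pdivlMr // div1r hM1.
  have M20 : (0 < M2)%N by rewrite leq_max M10 orbT.
  (* If d x is an integer then so are its multiples, some of which would be in [far]. *)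
  have [d /andP[d0 _] [a ha]|e e0 he] := near_int_gap R x M2.
    have := far (M2 * d)%N (M2%:Z * a); rewrite leq_pmulr // => /(_ isT).
    rewrite intrM natrM -mulrA ha subrr normr0 ltNge mulr_ge0 ?ltW ?eta0 //.
    by rewrite muln_gt0 M20.
  (* A value below [e] excludes the small differences; a value below 1 excludes the neutral element
     in [delta_min]. *)
  have e1 : 0 < Num.min e 1 by rewrite lt_min e0 ltr01.
  have [M3 [M30 hM3]] := small _ e1.
  have [N [M3N [N2 hN]]] := xA M3; rewrite -/(floor_nlogn R N) in hN.
  set L := floor_nlogn R N in hN; have NL : (N <= L)%N := floor_nlogn_ge R N.
  have := hM3 L (leq_trans M3N NL); rewrite lt_min => /andP[Le L1].
  have [d [/andP[d0 dN] [a ha]]] := delta_min_ex R x (eta L) N L1 hN.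
  have [dM|Md] := ltnP d M2.
    by have := he d _ a; rewrite d0 dM => /(_ isT); rewrite leNgt (le_lt_trans ha).
  have := far d a Md; rewrite ltNge => /negP; apply; apply: (le_trans ha).
  have L0 : (0 < L)%N by apply: leq_trans NL; apply: leq_trans N2.
  rewrite /C mulrC ler_pdivlMr ?exprn_gt0 // mulrC.
  apply: le_trans (doubling_pow2 R eta c0 k L c0p eta0 dbl L0) _.
  by apply: antitone_nat => //; apply: leq_trans dN _; exact: hk.
have unb B : exists N, B <= \sum_(1 <= q < N.+1) eta q.
  apply: contrapT => /forallNP nB; apply: nucvg; apply: (nondecreasing_is_cvgn ndu).
  exists B => _ [n _ <-]; apply: le_trans (uS n) _.
  by have /negP := nB n; rewrite -ltNge => /ltW.
have [k [c [k0 c1 dens]]] := prime_difference_density R.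
have [j hj] := floor_nlogn_primes_below_le R.
have [i hi] := ex_pow2_ge R k^-1.
pose D d := (0 < d)%N && balanced_difference R k d.
(* For a balanced q = p_N - p one has floor(N log N) <= 2 ^ j p_N and p_N <= q / k <= 2 ^ i q, so
   eta'(q) is at most eta at floor(N log N). *)
pose eta' q := c0 ^+ (j + i) * eta q.
have cji : 0 < c0 ^+ (j + i) by rewrite exprn_gt0.
have W0 : @lebesgue_measure R (`[0, 1]%classic `\` [set x | forall M, exists q,
    [/\ (M <= q)%N, D q & exists a : int, `|q%:R * x - a%:~R| <= eta' q]]) = 0%E.
  apply: (khintchine_dense R D k c eta') => //.
  - by move=> q /andP[].
  - by move=> q /andP[_ /asboolP[]].
  - have [N0 hN0] := dens; exists N0 => N /hN0 h; apply: (le_trans h).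
    by rewrite big_nat [leRHS]big_nat; apply: ler_sum => q /andP[q0 _]; rewrite /D q0.
  - by move=> q q0; rewrite mulr_ge0 ?ltW ?eta0.
  - by move=> q q0; rewrite ler_pM2l // ltW ?dec.
  - move=> B; have [N hN] := unb (B / c0 ^+ (j + i)); exists N.
    by rewrite -mulr_sumr mulrC -ler_pdivrMr.
apply/eqP; rewrite eq_le; apply/andP; split.
  have <- : @lebesgue_measure R `[0, 1]%classic = 1%E.
    by rewrite lebesgue_measure_itv /= lte_fin ltr01 -EFinB subr0.
  by apply: le_lebesgue => x [x01 _]; rewrite /= in_itv.
have -> : 1%:E = @lebesgue_measure R `[0, 1]%classic.
  by rewrite lebesgue_measure_itv /= lte_fin ltr01 -EFinB subr0.
(* Subadditivity: [0, 1] is covered by [A] and the null set in [W0]. *)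
rewrite -[leRHS]adde0 -W0; apply: le_trans (lebesgueU2 _ _ _); apply: le_lebesgue.
move=> x x01; have [xW|xW] := pselect ([set x | forall M, exists q,
    [/\ (M <= q)%N, D q & exists a : int, `|q%:R * x - a%:~R| <= eta' q]] x); last by right.
left; split; first by move: x01; rewrite /= in_itv.
(* A difference q at least as large as the prime of index max(M, 2) forces the larger prime p + q to
   have index at least max(M, 2). *)
move=> M; have [q [Mq /andP[q0 /asboolP[_ [p [pp ppq kpq]]]] [a ha]]] :=
  xW (nth_prime (maxn M 2)).
pose N := primes_below (p + q).+1; pose m := primes_below p.+1; exists N.
have pN : nth_prime N = (p + q)%N := nth_prime_primes_below _ ppq.
have pm : nth_prime m = p := nth_prime_primes_below _ pp.
have MN : (maxn M 2 <= N)%N.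
  rewrite -(primes_below_nth_prime (maxn M 2)); apply: primes_below_mono; lia.
have [MN' N2] : (M <= N)%N /\ (2 <= N)%N by move: MN; rewrite geq_max => /andP[].
split => //; split => //.
have m0 : (0 < m)%N by rewrite /m primes_belowS pp addn1.
have mN : (m < N)%N.
  rewrite /N primes_belowS ppq addn1 ltnS; apply: primes_below_mono; lia.
apply: le_trans (delta_min_le R x N N m _ _ _) _; rewrite ?leqnn ?m0 ?(ltnW mN) ?gtn_eqF //=.
  by rewrite andbT; apply: leq_trans N2.
apply/dist_nintP; exists a; rewrite pN pm natrD [p%:R + _]addrC addrK.
apply: (le_trans ha); rewrite -/(floor_nlogn R N).
apply: le_trans (doubling_pow2 R eta c0 (j + i) q c0p eta0 dbl q0) _.
have L0 : (0 < floor_nlogn R N)%N.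
  by apply: leq_trans (floor_nlogn_ge R N); apply: leq_trans N2.
apply: antitone_nat => //; apply: leq_trans (hj (p + q)%N _) _; first by rewrite addn_gt0 q0 orbT.
rewrite expnD -mulnA leq_mul2l; apply/orP; right.
rewrite -(ler_nat R) natrM; apply: (@le_trans _ _ (k^-1 * q%:R)); last by rewrite ler_wpM2r.
by rewrite mulrC ler_pdivlMr // mulrC.
Qed.
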